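(* Let $p\in\{5,7\}$. Throughout, $n\ge 0$ denotes an arbitrary integer and $c$ an arbitrary positive integer divisible by $p$. (i) The following vanishing statements hold. \begin{itemize} \item (5-4) For every $1\le \ell\le 4$ and every positive $c$ with $5\mid c$: $S_{\infty\infty}^{(\ell)}(0,5n+4,c,\mu_5)=0$. \item (7-5,1) For every $1\le \ell\le 6$ and every positive $c$ with $7\mid c$, $\frac c7\cdot\ell\not\equiv 1 \pmod 7$ and $\frac c7\cdot \ell\not\equiv -1\pmod 7$: $S_{\infty\infty}^{(\ell)}(0,7n+5,c,\mu_7)=0$. \item (7-5,2) For every $1\le \ell\le 6$ and every positive integer $a$ with $7\nmid a$, $a\ell\equiv \pm 1\pmod 7$, and $c=7a$: \[ e(-\tfrac18)\,S_{\infty\infty}^{(\ell)}(0,7n+5,c,\mu_7)+2\sqrt7\,S_{0\infty}^{(\ell)}(0,7n+5,a,\mu_7;0)=0.\] \end{itemize} (ii) For all integers $n\ge 0$ and all positive integers $c$ divisible by $p$ (with $p=5$ in the first two identities and $p=7$ in the others), the following identities hold: \begin{align*} C_5^{2,4}\sin(\tfrac{\pi}5)S_{\infty\infty}^{(1)}(0,5n+1,c,\mu_5)+C_5^{4,2}\sin(\tfrac{2\pi}5)S_{\infty\infty}^{(2)}(0,5n+1,c,\mu_5)&=0,\\ C_5^{0,4}\sin(\tfrac{\pi}5)S_{\infty\infty}^{(1)}(0,5n+2,c,\mu_5)+C_5^{0,2}\sin(\tfrac{2\pi}5)S_{\infty\infty}^{(2)}(0,5n+2,c,\mu_5)&=0,\\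 C_7^{4,6}S_7^{(1)}(7n,c)+C_7^{6,2}S_7^{(2)}(7n,c)+C_7^{2,4}S_7^{(3)}(7n,c)&=0,\\ C_7^{2,4}S_7^{(1)}(7n+1,c)+C_7^{4,6}S_7^{(2)}(7n+1,c)+C_7^{6,2}S_7^{(3)}(7n+1,c)&=0,\\ C_7^{4,6}S_7^{(1)}(7n+1,c)+C_7^{6,2}S_7^{(2)}(7n+1,c)+C_7^{2,4}S_7^{(3)}(7n+1,c)&=0,\\ C_7^{0,6}S_7^{(1)}(7n+2,c)+C_7^{0,2}S_7^{(2)}(7n+2,c)+C_7^{0,4}S_7^{(3)}(7n+2,c)&=0,\\ C_7^{0,4}S_7^{(1)}(7n+3,c)+C_7^{0,6}S_7^{(2)}(7n+3,c)+C_7^{0,2}S_7^{(3)}(7n+3,c)&=0,\\ C_7^{2,6}S_7^{(1)}(7n+3,c)+C_7^{4,2}S_7^{(2)}(7n+3,c)+C_7^{6,4}S_7^{(3)}(7n+3,c)&=0,\\ C_7^{0,2}S_7^{(1)}(7n+4,c)+C_7^{0,4}S_7^{(2)}(7n+4,c)+C_7^{0,6}S_7^{(3)}(7n+4,c)&=0,\\ C_7^{2,6}S_7^{(1)}(7n+4,c)+C_7^{4,2}S_7^{(2)}(7n+4,c)+C_7^{6,4}S_7^{(3)}(7n+4,c)&=0,\\ \(C_7^{0,4}+C_7^{2,6}\)S_7^{(1)}(7n+6,c)+\(C_7^{0,6}+C_7^{4,2}\)S_7^{(2)}(7n+6,c)+\(C_7^{0,2}+C_7^{6,4}\)S_7^{(3)}(7n+6,c)&=0.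 \end{align*}
   Context: Notation: $e(x)=\exp(2\pi i x)$. For $x\in\mathbb R$, $((x))=x-\lfloor x\rfloor-\frac12$ if $x\notin\mathbb Z$ and $((x))=0$ if $x\in\mathbb Z$. For integers $c>0$ and $d$ with $\gcd(d,c)=1$, the Dedekind sum is $s(d,c)=\sum_{r \bmod c}((r/c))((dr/c))$. ''$d \bmod c^*$'' means $d$ runs over reduced residue classes modulo $c$. For an integer $x$, $[x]$ denotes the least non-negative residue of $x$ modulo $7$. Kloosterman sum at $\infty\infty$: for $p\in\{5,7\}$, $1\le\ell\le p-1$, integer $n$, and a positive integer $c$ with $p\mid c$, \[S_{\infty\infty}^{(\ell)}(0,n,c,\mu_p)=e(-\tfrac18)\sum_{\substack{d \bmod c^*\\ ad\equiv 1 \pmod c}}\frac{(-1)^{\ell c}\,e\!\left(-\frac{3ca\ell^2}{2p^2}\right)}{\sin(\frac{\pi a\ell}{p})}\,e^{-\pi i s(d,c)}\,e\!\left(\frac{nd}{c}\right)\] (the summand does not depend on the choice of representatives $d$ and $a$ modulo $c$). Here $\mu_p$ is only part of the notation. Kloosterman sum at $0\infty$ (for $p=7$): for $1\le \ell\le 6$, an integer $n$ and a positive integer $A$: if $A\ell=7T+1$ for an integer $T\ge0$, \[S_{0\infty}^{(\ell)}(0,n,A,\mu_7;0)=(-1)^{A\ell-[A\ell]}\sum_{\substack{B \bmod A^*\\ 0\le C<7A,\ 7\mid C\\ BC\equiv -1 \pmod A}} e\!\left(\frac{(\frac32T^2+\frac12T)C}{A}\right)e^{-\pi i s(B,A)}e\!\left(\frac{nB}{A}\right);\]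 if $A\ell=7T-1$ for an integer $T\ge1$, \[S_{0\infty}^{(\ell)}(0,n,A,\mu_7;0)=(-1)^{A\ell-[A\ell]}\sum_{\substack{B \bmod A^*\\ 0\le C<7A,\ 7\mid C\\ BC\equiv -1 \pmod A}} e\!\left(\frac{(\frac32(T-1)^2+\frac52(T-1)+1)C}{A}\right)e^{-\pi i s(B,A)}e\!\left(\frac{nB}{A}\right);\] and if $[A\ell]\notin\{1,6\}$ then $S_{0\infty}^{(\ell)}(0,n,A,\mu_7;0)=0$. For $p\in\{5,7\}$ and integers $a,b$: $C_p^{a,b}=\cos(\frac{a\pi}{p})-\cos(\frac{b\pi}{p})$. For $1\le \ell\le 6$, an integer $n$ and a positive integer $c$ with $7\mid c$, writing $a=c/7$, \[S_7^{(\ell)}(n,c)=\sin(\tfrac{\pi\ell}7)\left(e(-\tfrac18)S_{\infty\infty}^{(\ell)}(0,n,c,\mu_7)+\mathbf 1_{[a\ell]\in\{1,6\}}\cdot 2\sqrt7\,S_{0\infty}^{(\ell)}(0,n,a,\mu_7;0)\right),\] where $\mathbf 1_{\text{condition}}$ is $1$ if the condition holds and $0$ otherwise. *)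

(* Defs.v *)
From mathcomp Require Import all_boot all_order all_algebra.
From mathcomp Require Import complex reals trigo.

Set Implicit Arguments.
Unset Strict Implicit.
Unset Printing Implicit Defensive.

Import Order.TTheory GRing.Theory Num.Theory.

Local Open Scope ring_scope.
Local Open Scope complex_scope.

Section Kloosterman.
Context {R : realType}.

Definition expi (t : R) : R[i] := cos t +i* sin t.

(* e(x) = exp(2 pi i x) for real x *)
Definition e2pi (x : R) : R[i] := expi (2 * pi * x).

(* the sawtooth function ((x)) *)
Definition sawtooth (x : R) : R :=
  if x \is a Num.int then 0 else x - (Num.floor x)%:~R - 1 / 2.

Definition dedekind_sum (d : int) (c : nat) : R :=
  \sum_(r < c) sawtooth (r%:R / c%:R) * sawtooth (d%:~R * r%:R / c%:R).

(* S_{oo oo}^{(l)}(0, n, c, mu_p), meaningful for c > 0 with p %| c.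
   The classes d and a modulo c are represented in [0, c); for each d
   coprime to c the inner sum has exactly one term. *)
Definition S_inf_inf (p l : nat) (n : int) (c : nat) : R[i] :=
  e2pi (- (1 / 8)) *
  \sum_(d < c | coprime d c) \sum_(a < c | (a * d == 1 %[mod c])%N)
    ((-1) ^+ (l * c) * e2pi (- ((3 * c * a * l ^ 2)%N%:R / (2 * p ^ 2)%N%:R))
       / (sin (pi * (a * l)%N%:R / p%:R))%:C
     * expi (- (pi * dedekind_sum d c))
     * e2pi (n%:~R * d%:R / c%:R)).

(* The sum over B and C common to both nonzero cases of S_{0 oo}, where q is
   the coefficient of C / A. Under 7 %| C and coprime 7 A, for each B coprime
   to A there is exactly one C in [0, 7 A). *)
Definition S_zero_inf_sum (q : R) (n : int) (A : nat) : R[i] :=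
  \sum_(B < A | coprime B A)
    \sum_(C < 7 * A | (7 %| C)%N && ((B * C)%N%:Z == -1 %[mod A%:Z])%Z)
      (e2pi (q * C%:R / A%:R)
       * expi (- (pi * dedekind_sum B A))
       * e2pi (n%:~R * B%:R / A%:R)).

(* S_{0 oo}^{(l)}(0, n, A, mu_7; 0), meaningful for A > 0; the two cases are
   A l = 7 T + 1 and A l = 7 T - 1. *)
Definition S_zero_inf (l : nat) (n : int) (A : nat) : R[i] :=
  let sgn : R[i] := (-1) ^+ (A * l - (A * l) %% 7)%N in
  if ((A * l) %% 7 == 1)%N then
    let T : R := ((A * l) %/ 7)%N%:R in
    sgn * S_zero_inf_sum (3 / 2 * T ^+ 2 + 1 / 2 * T) n A
  else if ((A * l) %% 7 == 6)%N then
    let T : R := ((A * l).+1 %/ 7)%N%:R in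
    sgn * S_zero_inf_sum (3 / 2 * (T - 1) ^+ 2 + 5 / 2 * (T - 1) + 1) n A
  else 0.

(* C_p^{a,b}, embedded in R[i] *)
Definition Ccos (p : nat) (a b : int) : R[i] :=
  (cos (a%:~R * pi / p%:R) - cos (b%:~R * pi / p%:R))%:C.

Definition sin_frac_pi (k p : nat) : R[i] := (sin (k%:R * pi / p%:R))%:C.

(* S_7^{(l)}(n, c), meaningful for c > 0 with 7 %| c *)
Definition S7 (l : nat) (n : int) (c : nat) : R[i] :=
  let a := (c %/ 7)%N in
  sin_frac_pi l 7 *
  (e2pi (- (1 / 8)) * S_inf_inf 7 l n c
   + (((a * l) %% 7 == 1) || ((a * l) %% 7 == 6))%N%:R
     * (2 * (Num.sqrt 7)%:C * S_zero_inf l n a)).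

End Kloosterman.

(* Main.v *)
(** The Dedekind sum satisfies [e^{-pi i s(d, c)} = (c / d) e(phase)] with a rational
    phase linear in [a + d], [a c] and [a], where [a d = 1 mod 24 c] and [d] is prime
    to 6 (the eta multiplier).  It follows from the reciprocity law, read modulo 3 and
    modulo 8, together with Gauss's lemma for the half-system of odd residues.
    Write [c = p k].  Along the fibre of [d mod k] the factor [e^{-pi i s(d, c)}] equals
    [e^{-pi i s(d, k)}], which is constant, times an explicit quadratic character and
    [p]-th root of unity, so each fibre contributes a constant independent of [l] times
    an element of the [p]-th cyclotomic field depending only on residues modulo [p].
    Every claimed identity thus becomes finitely many identities between formal sums
    of powers of a [p]-th root of unity, which are decided by computation; for [p = 7]
    and [k] prime to 7 the sum at [0 oo] has the same fibre constants, and
    [sqrt 7] is expressed by the quadratic Gauss sum. *)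

Require Import Defs.
From mathcomp Require Import all_boot all_order all_algebra.
From mathcomp Require Import complex reals trigo.
From mathcomp Require Import cyclic.
From mathcomp Require Import zify ring lra.

Set Implicit Arguments.
Unset Strict Implicit.
Unset Printing Implicit Defensive.

Import Order.TTheory GRing.Theory Num.Theory.

(** * Dedekind sums and the reciprocity law *)

(** The multiplier formula asks for [d] prime to 6 and for an inverse modulo [24 c], whereas the sum
    knows [d] only modulo [c]. Each fibre is therefore walked in steps of [24 k], which is harmless
    as 24 is prime to [p]. Along such steps the residue of [d] modulo [24 k] is frozen, hence so are
    its parity, the residue modulo 4 that decides the reciprocity sign, and all phases with
    denominator [24 k]; only a power of the [p]-th root of unity, the symbol modulo [p] and the sine
    can move. Two obstacles remain. The sine stands in a denominator; it is made polynomial by the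
    identity [(z - 1) * sum j z^j = p] for a [p]-th root of unity [z] other than 1. Half-integral
    phases and [sin (pi a l / p)] produce signs depending on lifts; since inverses modulo 24 are
    odd, these collapse to [(-1)^l], and the sines of the claimed identities carry the same sign
    once they are rewritten at even multiples of [pi / p]. *)

Lemma sum_modn_reindex (V : nmodType) (h k : nat) (F : nat -> V) :
  coprime h k -> (\sum_(r < k) F (h * r %% k)%N = \sum_(r < k) F r)%R.
Proof.
move=> co; case: k co => [|k] co; first by rewrite !big_ord0.
pose f (r : 'I_k.+1) : 'I_k.+1 := inord (h * r %% k.+1).
have fE r : f r = h * r %% k.+1 :> nat by rewrite inordK // ltn_mod.
have finj : injective f.
  move=> r s /(congr1 val) /=; rewrite !fE => E; apply/val_inj.
  wlog le : r s E / s <= r.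
    move=> H; case/orP: (leq_total s r) => [|l]; first exact: H.
    exact/esym/H.
  move/eqP: E.
  rewrite eqn_mod_dvd ?leq_mul2l ?le ?orbT // -mulnBr Gauss_dvdr; last by rewrite coprime_sym.
  move=> /dvdn_leq H; have := ltn_ord r => lr; apply/eqP; rewrite eqn_leq le andbT -subn_eq0.
  by rewrite -leqn0 leqNgt; apply/negP => /H; lia.
by rewrite [RHS](reindex_inj finj); apply: eq_bigr => r _; rewrite fE.
Qed.

(** The part of the Dedekind sum that is not polynomial in [h] and [k]: the sum of [r (h r %% k)] is
    [h] times the sum of the squares [r ^ 2] minus [k] times this quantity. *)
Definition wfloor (h k : nat) : nat := \sum_(r < k) r * (h * r %/ k).

Lemma sum_double_le (h q : nat) :
  \sum_(m < h) (m <= q) * (2 * m) = if q < h then q * q.+1 else h * h.-1.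
Proof.
elim: h => [|h IH]; first by rewrite big_ord0.
rewrite big_ord_recr /= IH ltnS.
case: (ltngtP q h) => [l|l|<-]; rewrite ?mul0n ?mul1n; nia.
Qed.

Lemma sum_gt_ord (k q : nat) : \sum_(r < k) (q < r) = k.-1 - q.
Proof.
elim: k => [|k IH]; first by rewrite big_ord0.
by rewrite big_ord_recr /= IH; case: (ltnP q k); lia.
Qed.

(* Lattice points: [q * (q + 1)] is the sum of [2 * m] over [m <= q], and for [0 < m < h]
   exactly [k - 1 - k m %/ h] indices [r] satisfy [m <= h r %/ k]. *)
Lemma sum_floor_sq (h k : nat) : coprime h k -> 0 < h -> 0 < k ->
  \sum_(r < k) (h * r %/ k) ^ 2 + \sum_(r < k) (h * r %/ k) + 2 * wfloor k h
  = k.-1 * (h * h.-1).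
Proof.
move=> co h0 k0.
have -> : \sum_(r < k) (h * r %/ k) ^ 2 + \sum_(r < k) (h * r %/ k)
   = \sum_(m < h) 2 * m * (k.-1 - k * m %/ h).
  rewrite -big_split /=.
  under eq_bigr => r _.
    have -> : (h * r %/ k) ^ 2 + h * r %/ k = \sum_(m < h) (m <= h * r %/ k) * (2 * m).
      rewrite sum_double_le ltn_divLR // ltn_mul2l h0 ltn_ord /=; lia.
    over.
  rewrite exchange_big /=; apply: eq_bigr => m _.
  rewrite -big_distrl /= mulnC.
  case: (posnP m) => [-> //|m0]; congr (_ * _).
  rewrite -sum_gt_ord; apply: eq_bigr => r _; congr nat_of_bool.
  (* The two conditions become [m k <= h r] and [k m < h r]. Equality would force [h] to divide [m],
     which [0 < m < h] excludes. *)
  rewrite leq_divRL // ltn_divLR // leq_eqVlt (mulnC m) (mulnC h).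
  case: eqP => //= E.
  have : h %| m by rewrite -(@Gauss_dvdr _ k) // E dvdn_mull.
  by move=> /(dvdn_leq m0); have := ltn_ord m; lia.
rewrite /wfloor big_distrr /= -big_split /=.
have <- : \sum_(m < h) 2 * m = h * h.-1.
  have := sum_double_le h h; rewrite ltnn => <-; apply: eq_bigr => m _.
  by rewrite (ltnW (ltn_ord m)) mul1n.
rewrite big_distrr /=; apply: eq_bigr => m _.
have : k * m %/ h < k by rewrite ltn_divLR // ltn_mul2l k0 ltn_ord.
nia.
Qed.

Lemma sum_ord_nat (k : nat) : 2 * \sum_(r < k) r = k * k.-1.
Proof.
elim: k => [|k IH]; first by rewrite big_ord0.
by rewrite big_ord_recr mulnDr IH /=; case: k {IH} => //= k; nia.
Qed.

Lemma sum_ord_sq (k : nat) : 6 * \sum_(r < k) r ^ 2 = k * k.-1 * (2 * k).-1.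
Proof.
elim: k => [|k IH]; first by rewrite big_ord0.
by rewrite big_ord_recr mulnDr IH /=; case: k {IH} => //= k; nia.
Qed.

Local Open Scope ring_scope.

(* [12 k s(h, k)], see [dedekind_sumE]. *)
Definition dedN (h k : nat) : int :=
  2 * h%:Z * (k%:Z - 1) * (2 * k%:Z - 1) - 12 * (wfloor h k)%:Z
  - 3 * k%:Z * (k%:Z - 1).

Lemma sum_floor (h k : nat) : coprime h k -> (0 < k)%N ->
  2 * (\sum_(r < k) h * r %/ k)%N%:Z = (h%:Z - 1) * (k%:Z - 1).
Proof.
move=> co k0.
have E : (h * \sum_(r < k) r = k * (\sum_(r < k) h * r %/ k) + \sum_(r < k) r)%N.
  rewrite -{2}(sum_modn_reindex (fun r => r) co) !big_distrr -big_split /=.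
  by apply: eq_bigr => r _; rewrite [LHS](divn_eq _ k) mulnC.
have := sum_ord_nat k; move: E k0.
move: (\sum_(r < k) r)%N (\sum_(r < k) h * r %/ k)%N => S M; nia.
Qed.

(** Write [h r = k m + t], square [h r - k m = t] and sum over [r]. The remainders [t] permute the
    indices, so both sums of squares are known, and a factor [k] cancels. *)
Lemma dedN_floor_sq (h k : nat) : coprime h k -> (0 < k)%N ->
  12 * h%:Z * (wfloor h k)%:Z
  = (h%:Z ^+ 2 - 1) * (k%:Z - 1) * (2 * k%:Z - 1)
    + 6 * k%:Z * (\sum_(r < k) (h * r %/ k) ^ 2)%N%:Z.
Proof.
move=> co k0.
have E : (h ^ 2 * \sum_(r < k) r ^ 2 + k ^ 2 * (\sum_(r < k) (h * r %/ k) ^ 2)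
    = 2 * h * k * wfloor h k + \sum_(r < k) r ^ 2)%N.
  rewrite -{2}(sum_modn_reindex (fun r => r ^ 2)%N co) /wfloor !big_distrr -!big_split /=.
  apply: eq_bigr => r _; have := divn_eq (h * r) k.
  move: (h * r %/ k)%N (h * r %% k)%N => m t.
  move=> E; rewrite -expnMn E; have : (h * r * m = (m * k + t) * m)%N by rewrite E.
  nia.
have := sum_ord_sq k; move: E k0.
move: (\sum_(r < k) r ^ 2)%N (\sum_(r < k) (h * r %/ k) ^ 2)%N (wfloor h k) => S M T E k0 E6.
have k00 : k%:Z != 0 by lia.
have Ez : h%:Z ^+ 2 * S%:Z + k%:Z ^+ 2 * M%:Z = 2 * h%:Z * k%:Z * T%:Z + S%:Z by lia.
have E6z : 6 * S%:Z = k%:Z * (k%:Z - 1) * (2 * k%:Z - 1).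
  have <- : k.-1%:Z = k%:Z - 1 by lia.
  have <- : (2 * k)%N.-1%:Z = 2 * k%:Z - 1 by lia.
  by rewrite -!PoszM -E6; lia.
apply: (mulfI k00).
have -> : k%:Z * (12 * h%:Z * T%:Z) = 6 * (2 * h%:Z * k%:Z * T%:Z + S%:Z) - 6 * S%:Z by ring.
rewrite -Ez; transitivity ((h%:Z ^+ 2 - 1) * (6 * S%:Z) + 6 * k%:Z ^+ 2 * M%:Z); first by ring.
by rewrite E6z; ring.
Qed.

(** Dedekind's law for [s(h, k) + s(k, h)], multiplied by [12 h k]. The sum of squared floors enters
    through both [wfloor h k] and [wfloor k h] and cancels; the linear floor sum that is left is
    given by [sum_floor]. *)
Lemma dedN_reciprocity (h k : nat) : coprime h k -> (0 < h)%N -> (0 < k)%N ->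
  h%:Z * dedN h k + k%:Z * dedN k h
  = h%:Z ^+ 2 + k%:Z ^+ 2 + 1 - 3 * h%:Z * k%:Z.
Proof.
move=> co h0 k0; have := dedN_floor_sq co k0; have := sum_floor co k0.
have := sum_floor_sq co h0 k0; rewrite /dedN.
move: (\sum_(r < k) (h * r %/ k) ^ 2)%N (\sum_(r < k) h * r %/ k)%N (wfloor h k) (wfloor k h).
move=> A B C D E1 E2 E3.
have E4 : A%:Z + B%:Z + 2 * D%:Z = (k%:Z - 1) * (h%:Z * (h%:Z - 1)).
  have <- : k.-1%:Z = k%:Z - 1 by lia.
  have <- : h.-1%:Z = h%:Z - 1 by lia.
  by rewrite -!PoszM -E1; lia.
transitivity (2 * h%:Z ^+ 2 * (k%:Z - 1) * (2 * k%:Z - 1) - 12 * h%:Z * C%:Z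
  - 3 * h%:Z * k%:Z * (k%:Z - 1) + 2 * k%:Z ^+ 2 * (h%:Z - 1) * (2 * h%:Z - 1)
  - 3 * k%:Z * h%:Z * (h%:Z - 1) - 6 * k%:Z * (A%:Z + B%:Z + 2 * D%:Z)
  + 6 * k%:Z * A%:Z + 3 * k%:Z * (2 * B%:Z)); first by ring.
by rewrite E3 E2 E4; ring.
Qed.

Lemma dedN_mod3 (h k : nat) : ~~ (3 %| k)%N -> (3 %| dedN h k)%Z.
Proof.
move=> k3; have : (3 %| (k%:Z - 1) * (2 * k%:Z - 1))%Z.
  have [E|E] : (k %% 3 = 1 \/ k %% 3 = 2)%N by lia.
    by apply: dvdz_mulr; lia.
  by apply: dvdz_mull; lia.
rewrite /dedN => /dvdzP[q E].
have -> : 2 * h%:Z * (k%:Z - 1) * (2 * k%:Z - 1) = 2 * h%:Z * ((k%:Z - 1) * (2 * k%:Z - 1)) by ring.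
rewrite E; apply/dvdzP; exists (2 * h%:Z * q - 4 * (wfloor h k)%:Z - k%:Z * (k%:Z - 1)); ring.
Qed.

(** * The Jacobi symbol *)

Local Close Scope ring_scope.

(* For odd [k], [(-1) ^+ jac h k] is the Jacobi symbol [(h / k)], computed as in Gauss's
   lemma with the odd residues as half-system. *)
Definition jac (h k : nat) : bool :=
  odd (count (fun r => odd r && ~~ odd (h * r %% k)) (iota 0 k)).

Lemma jacE (h k : nat) :
  jac h k = \big[addb/false]_(r < k) (odd r && ~~ odd (h * r %% k)).
Proof.
rewrite /jac -sumn_count sumnE big_map -{1}(subn0 k) -/(index_iota 0 k) big_mkord.
by rewrite (big_morph odd oddD (erefl _)); apply: eq_bigr => r _; rewrite oddb.
Qed.

Lemma jac_congr (g h k : nat) : g = h %[mod k] -> jac g k = jac h k.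
Proof.
by move=> E; congr odd; apply: eq_count => r; rewrite /= -(modnMml g) E modnMml.
Qed.

(* [s r] is the odd or even representative of [+- h r] having the parity of [r]; it
   permutes the residues, and the signs compose. *)
Lemma jacM (g h k : nat) : odd k -> coprime g k -> coprime h k ->
  jac (g * h) k = jac g k (+) jac h k.
Proof.
case: k => // k; set K := k.+1 => oddk cog coh.
have nz f r : coprime f K -> r < K -> f * r %% K = 0 -> r = 0.
  move=> cof rk /eqP; rewrite -/(dvdn _ _) Gauss_dvdr 1?coprime_sym //.
  by case: r rk => // r rk /(dvdn_leq _) H; have := H isT; lia.
pose s r := if odd (h * r %% K) == odd r then h * r %% K else K - h * r %% K.
have tK r : h * r %% K < K by rewrite ltn_mod.
have s_odd (r : 'I_K) : odd (s r) = odd r.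
  rewrite /s; case: eqP => // ne; rewrite oddB ?(ltnW (tK r)) // oddk.
  by move: ne; do 2![case: odd].
have s_lt (r : 'I_K) : s r < K.
  rewrite /s; case: eqP => // ne.
  have : h * r %% K <> 0 by move=> E; apply: ne; rewrite E (nz h r).
  by have := tK r; lia.
pose sg (r : 'I_K) : 'I_K := Ordinal (s_lt r).
have inj : injective sg.
  move=> r t /(congr1 val) /= E.
  have par : odd r = odd t by rewrite -s_odd -(s_odd t) E.
  have key u v : u < K -> v <= u -> h * u = h * v %[mod K] -> u = v.
    move=> uK vu /eqP; rewrite eqn_mod_dvd ?leq_mul2l ?vu ?orbT // -mulnBr.
    rewrite Gauss_dvdr 1?coprime_sym // => /dvdn_leq H; apply/eqP.
    by rewrite eqn_leq vu andbT -subn_eq0 -leqn0 leqNgt; apply/negP => /H; lia.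
  (* Here [K] divides [u + v < 2 K]. The value [K] is odd, contrary to equal parities, so
     [u + v = 0]. *)
  have key2 u v : u < K -> v < K -> odd u = odd v ->
      h * u %% K = K - h * v %% K -> u = v.
    move=> uK vK pv E1.
    have : K %| h * (u + v).
      rewrite mulnDr /dvdn -modnDm E1 subnK ?modnn //; exact/ltnW/tK.
    rewrite Gauss_dvdr 1?coprime_sym // => /dvdnP [[|[|q]]] E2; [lia| |lia].
    by have := congr1 odd E2; rewrite mul1n oddk oddD pv addbb.
  apply/val_inj => /=; move: E; rewrite /s -par.
  case: eqP => _; case: eqP => _.
  - case: (leqP t r) => l E; first exact: key.
    by apply/esym/key => //; exact: ltnW.
  - exact: key2.
  - by move=> E; apply/esym/key2.
  - move=> E; have {}E : h * r %% K = h * t %% K by have := tK r; have := tK t; lia.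
    case: (leqP t r) => l; first exact: key.
    by apply/esym/key => //; exact: ltnW.
rewrite !jacE [X in X (+) _](reindex_inj inj) -big_split /=.
apply: eq_bigr => r _; rewrite s_odd; case rodd: (odd r) => //=.
rewrite -mulnA -modnMmr {1}/s rodd; case todd: (odd (h * r %% K)) => /=; first by rewrite addbF.
have t0 : h * r %% K <> 0 by move=> E; move: rodd; rewrite (nz h r).
move: (h * r %% K) (tK r) todd t0 => t tk todd t0.
have gt0 : g * t %% K <> 0 by move=> /(nz g) H; apply: t0; apply: H.
have -> : g * (K - t) %% K = K - g * t %% K.
  have lt1 : g * t %% K < K by rewrite ltn_mod.
  rewrite -[RHS](@modn_small _ K); last by lia.
  apply/eqP; rewrite -(eqn_modDr (g * t)) -mulnDr subnK; last exact: ltnW.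
  by rewrite -[X in _ == X]modnDmr subnK ?modnMl ?modnn // ltnW.
rewrite oddB ?oddk; last by apply: ltnW; rewrite ltn_mod.
by case: odd.
Qed.

Local Open Scope ring_scope.

(** The congruence [12 k s(h, k) = k + 1 - 2 (h / k)] modulo 8. Only the parity of [wfloor] matters;
    modulo 2 and for odd [r], the division [h r = q k + t] gives [q + h + 1 = t + 1], so each odd
    [r] contributes the condition counted by [jac]. *)
Lemma dedN_mod8 (h k : nat) : odd k ->
  (8 %| dedN h k - (k%:Z - 1 + 4 * (jac h k)%:Z))%Z.
Proof.
move=> oddk; have [m km] : exists m, k = m.*2.+1.
  by exists k./2; rewrite -[LHS]odd_double_half oddk.
have cnt : (\sum_(r < k) odd r = m)%N.
  rewrite km; elim: (m) => [|i IH]; first by rewrite big_ord_recr big_ord0.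
  by rewrite doubleS big_ord_recr big_ord_recr IH /= odd_double /= addn1 addn0.
have par : odd (wfloor h k + h.+1 * m) = jac h k.
  rewrite -cnt big_distrr /= -big_split /= (big_morph odd oddD (erefl _)) jacE.
  apply: eq_bigr => r _; have := congr1 odd (divn_eq (h * r) k).
  rewrite !(oddD, oddM, oddS) oddb oddk andbT.
  by do 4![case: odd => //=].
have := odd_double_half (wfloor h k + h.+1 * m); rewrite par.
rewrite /dedN km; move: (wfloor h _) (jac h _) (half _) => T j q E.
have {E} E : T%:Z = j%:Z + 2 * q%:Z - (h%:Z + 1) * m%:Z by case: j E => /=; lia.
(* [m (3 m + 1)] is even, which turns the remaining term [4 m (3 m + 1)] into a multiple of 8. *)
have [z Ez] : exists z : int, m%:Z * (1 + 3 * m%:Z) = 2 * z.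
  have [e|e] : (m = m./2.*2 \/ m = m./2.*2.+1)%N by lia.
    by exists (m./2%:Z * (1 + 3 * m%:Z)); rewrite {1}e; lia.
  by exists (m%:Z * (3 * m./2%:Z + 2)); rewrite {2}e; lia.
apply/dvdzP; exists (2 * h%:Z * m%:Z ^+ 2 + 2 * h%:Z * m%:Z - 2 * j%:Z - 3 * q%:Z
   + m%:Z - z).
rewrite E.
have -> : m.*2.+1%:Z = 2 * m%:Z + 1 by lia.
transitivity (16 * h%:Z * m%:Z ^+ 2 + 16 * h%:Z * m%:Z - 16 * j%:Z - 24 * q%:Z 
   + 8 * m%:Z - 4 * (m%:Z * (1 + 3 * m%:Z))); first by ring.
by rewrite Ez; ring.
Qed.

(** Quadratic reciprocity. Modulo 8, [dedN_mod8] leaves in [dedN_reciprocity] only the two symbols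
    and the residues of [c] and [d], so all cases can be enumerated. *)
Lemma jac_flip (c d : nat) : coprime c d -> odd c -> odd d ->
  jac c d (+) jac d c = (c %% 4 == 3)%N && (d %% 4 == 3)%N.
Proof.
move=> co oc od.
have := dedN_mod8 c od; have := dedN_mod8 d oc.
have := dedN_reciprocity co (odd_gt0 oc) (odd_gt0 od).
move=> E /dvdzP [x /(canRL (subrK _)) Ex] /dvdzP [y /(canRL (subrK _)) Ey].
move: E; rewrite {}Ex {}Ey.
have [c' [r [{}oc rE]]] : exists c' r : nat, c = (8 * c' + r)%N /\ (r \in [:: 1; 3; 5; 7]%N).
  by exists (c %/ 8)%N, (c %% 8)%N; split; [lia|rewrite !inE; lia].
have [d' [s [{}od sE]]] : exists c' r : nat, d = (8 * c' + r)%N /\ (r \in [:: 1; 3; 5; 7]%N).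
  by exists (d %/ 8)%N, (d %% 8)%N; split; [lia|rewrite !inE; lia].
have [c4 d4] : (c %% 4 = r %% 4)%N /\ (d %% 4 = s %% 4)%N by lia.
rewrite c4 d4; move: (jac c d) (jac d c); 
have -> : c%:Z = 8 * c'%:Z + r%:Z by lia.
have -> : d%:Z = 8 * d'%:Z + s%:Z by lia.
move: c'%:Z d'%:Z => u v {c4 d4 oc od co c' d'}.
move: rE sE; rewrite !inE.
by do 2![case/or4P => /eqP ->]; case; case => //=; lia.
Qed.

(* Adding [m * n] to [w] makes it odd, and then [jac_flip] reduces the claim to [jacM]. *)
Lemma jac_mulr (w m n : nat) : odd m -> odd n -> coprime w (m * n) ->
  jac w (m * n) = jac w m (+) jac w n.
Proof.
move=> om on; wlog ow : w / odd w => [H|].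
  case ow: (odd w); first exact: H.
  move=> co; rewrite (@jac_congr w (w + m * n) (m * n)); last by rewrite modnDr.
  rewrite (@jac_congr w (w + m * n) m); last by rewrite addnC mulnC modnMDl.
  rewrite (@jac_congr w (w + m * n) n); last by rewrite addnC modnMDl.
  apply: H; first by rewrite oddD ow oddM om on.
  by rewrite /coprime gcdnC gcdnDr gcdnC.
rewrite coprimeMr => /andP[cm cn].
have co : coprime w (m * n) by rewrite coprimeMr cm.
have f1 := jac_flip co ow; rewrite oddM om on in f1.
have f2 := jac_flip cm ow om; have f3 := jac_flip cn ow on.
rewrite jacM // 1?coprime_sym // in f1.
have [u [x [{}om xE]]] : exists c' r : nat, m = (4 * c' + r)%N /\ (r \in [:: 1; 3]%N).
  by exists (m %/ 4)%N, (m %% 4)%N; split; [lia|rewrite !inE; lia].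
have [v [y [{}on yE]]] : exists c' r : nat, n = (4 * c' + r)%N /\ (r \in [:: 1; 3]%N).
  by exists (n %/ 4)%N, (n %% 4)%N; split; [lia|rewrite !inE; lia].
have m4 : (m %% 4 = x %% 4)%N by lia.
have n4 : (n %% 4 = y %% 4)%N by lia.
have mn4 : ((m * n) %% 4 = (x * y) %% 4)%N by rewrite -modnMm m4 n4 modnMm.
move: f1 f2 f3; rewrite mn4 m4 n4 => /(_ isT).
move: (jac w (m * n)) (jac w m) (jac w n) (jac m w) (jac n w) => a1 a2 a3 a4 a5.
by move: xE yE; rewrite !inE; do 2![case/orP => /eqP ->]; case: (w %% 4 == 3)%N;
  case: a1; case: a2; case: a3; case: a4; case: a5.
Qed.

Local Open Scope complex_scope.

(** * Exponentials *)

Section Exponentials.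
Variable R : realType.
Implicit Types x y : R.

Lemma expiD x y : expi (x + y) = expi x * expi y.
Proof. by rewrite /expi cosD sinD; apply/eqP; rewrite eq_complex /= eqxx addrC eqxx. Qed.

Lemma e2piD x y : e2pi (x + y) = e2pi x * e2pi y.
Proof. by rewrite /e2pi mulrDr expiD. Qed.

Lemma e2pi0 : e2pi (0 : R) = 1.
Proof. by rewrite /e2pi mulr0 /expi cos0 sin0. Qed.

Lemma e2piMn x n : e2pi (x * n%:R) = e2pi x ^+ n.
Proof.
elim: n => [|n IH]; first by rewrite mulr0 e2pi0.
by rewrite exprS -IH -e2piD; congr e2pi; rewrite -natr1; ring.
Qed.

Lemma e2pi_half (n : nat) : e2pi (n%:R / 2 : R) = (-1) ^+ n.
Proof.
rewrite mulrC e2piMn; congr (_ ^+ _); rewrite /e2pi.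
rewrite (_ : 2 * pi * 2^-1 = pi) /expi; last by field.
by rewrite cospi sinpi; apply/eqP; rewrite eq_complex /= oppr0 !eqxx.
Qed.

Lemma e2pi_int (m : int) : e2pi (m%:~R : R) = 1.
Proof.
have nat_case n : e2pi (n%:R : R) = 1.
  rewrite -[n%:R]mul1r e2piMn (_ : (1 : R) = 2%:R / 2); last by rewrite divff ?pnatr_eq0.
  by rewrite e2pi_half sqrrN !expr1n.
case: m => n; first exact: nat_case.
rewrite NegzE mulrNz -[LHS]mulr1 -{1}(nat_case n.+1) -e2piD addNr.
exact: e2pi0.
Qed.

(** Phase comparisons below name the integer [m] explicitly, so that what remains is a rational
    identity for [field]. *)
Lemma e2pi_congr (m : int) x y : x = y + m%:~R -> e2pi x = e2pi y.
Proof. by move=> ->; rewrite e2piD e2pi_int mulr1. Qed.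

Lemma e2pi_neq0 x : e2pi x != 0.
Proof.
apply/eqP => E; have := e2piD x (- x); rewrite subrr e2pi0 E mul0r.
by apply/eqP; rewrite oner_eq0.
Qed.

Lemma sin_expi x : (sin x)%:C = (expi x - expi (- x)) / (2 * 'i).
Proof.
rewrite /expi cosN sinN; apply: (mulIf (_ : 2 * 'i != 0)).
  by rewrite mulf_neq0 ?pnatr_eq0 ?neq0Ci.
rewrite divfK ?mulf_neq0 ?pnatr_eq0 ?neq0Ci //.
apply/eqP; rewrite eq_complex /=; apply/andP; split; apply/eqP; simpc => /=; ring.
Qed.

Lemma cos_expi x : (cos x)%:C = (expi x + expi (- x)) / 2.
Proof.
rewrite /expi cosN sinN; apply: (mulIf (_ : (2 : R[i]) != 0)); first by rewrite pnatr_eq0.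
rewrite divfK ?pnatr_eq0 //.
apply/eqP; rewrite eq_complex /=; apply/andP; split; apply/eqP; simpc => /=; ring.
Qed.

End Exponentials.

(** * From the real Dedekind sum to the integer [dedN] *)

Section DedekindSums.
Variable R : realType.

Lemma sawtooth_frac (m k : nat) : (0 < k)%N ->
  sawtooth (m%:R / k%:R : R)
  = if (k %| m)%N then 0 else (m %% k)%N%:R / k%:R - 1 / 2.
Proof.
move=> k0; have kR : (0 : R) < k%:R by rewrite ltr0n.
have E : (m%:R / k%:R : R) = (m %/ k)%N%:R + (m %% k)%N%:R / k%:R.
  by rewrite {1}(divn_eq m k) natrD natrM mulrDl mulfK // lt0r_neq0.
have fl : Num.floor (m%:R / k%:R : R) = (m %/ k)%N.
  apply: floor_def; rewrite E -[(m %/ k)%N%:~R]/((m %/ k)%N%:R) lerDl intrD.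
  rewrite ltrD2l ltr_pdivrMr // mul1r ltr_nat ltn_mod k0 andbT.
  by rewrite divr_ge0 ?ler0n.
rewrite /sawtooth intrEfloor fl E -subr_eq0 opprD addrA subrr sub0r oppr_eq0.
rewrite mulf_eq0 invr_eq0 !pnatr_eq0 /dvdn.
case: (posnP (m %% k)%N) => [//|m0]; rewrite !gtn_eqF //=.
by rewrite -[(m %/ k)%N%:~R]/((m %/ k)%N%:R); ring.
Qed.

(* The correction [1 / 4] is the term [r = 0], where the sawtooth vanishes. *)
Lemma dedekind_sum_nat (h k : nat) : coprime h k -> (0 < k)%N ->
  dedekind_sum h k = \sum_(r < k) (r%:R / k%:R - 1 / 2)
      * ((h * r %% k)%N%:R / k%:R - 1 / 2) - 1 / 4 :> R.
Proof.
move=> co; case: k co => // k co _.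
rewrite /dedekind_sum !big_ord_recl /= muln0 mod0n.
rewrite mulr0 mul0r (_ : sawtooth 0 = 0); last first.
  by rewrite /sawtooth -[0]/(0%:~R) rpred_int.
rewrite mul0r add0r.
have -> (x : R) : (0 - 1 / 2) * (0 - 1 / 2) + x - 1 / 4 = x by field.
apply: eq_bigr => i _; set r := bump 0 i.
have r0 : (0 < r)%N by [].
have rk : (r < k.+1)%N by have := ltn_ord i; rewrite /r /bump; lia.
rewrite sawtooth_frac // -[_%:~R * _]natrM sawtooth_frac //.
rewrite Gauss_dvdr 1?coprime_sym //.
by rewrite gtnNdvd // modn_small.
Qed.

(** On expanding the product, the two linear sums agree because multiplication by [h] permutes the
    residues, and the quadratic one is expressed by [wfloor]. *)
Lemma dedekind_sumE (h k : nat) : coprime h k -> (0 < k)%N ->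
  (12 * k)%N%:R * dedekind_sum h k = (dedN h k)%:~R :> R.
Proof.
move=> co k0; rewrite dedekind_sum_nat //.
have kR : (k%:R : R) != 0 by rewrite pnatr_eq0 -lt0n.
pose P := (\sum_(r < k) r * (h * r %% k))%N.
pose S := (\sum_(r < k) r)%N.
have sumE : \sum_(r < k) (r%:R / k%:R - 1 / 2) * ((h * r %% k)%N%:R / k%:R - 1 / 2)
   = P%:R / k%:R ^+ 2 - S%:R / k%:R + k%:R / 4 :> R.
  rewrite (_ : k%:R / 4 = \sum_(r < k) (1 / 4 : R)); last first.
    by rewrite sumr_const card_ord -mulr_natl; field.
  rewrite (_ : S%:R / k%:R = S%:R / (2 * k%:R) + S%:R / (2 * k%:R) :> R); last first.
    by field.
  rewrite {2}/S -{1}(sum_modn_reindex (fun r => r) co) /P !natr_sum !mulr_suml opprD.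
  rewrite -!sumrN !addrA -!big_split /=; apply: eq_bigr => r _.
  by rewrite natrM; field.
have E1 : (2 * S%:R = k%:R * (k%:R - 1) :> R).
  by rewrite -natrM sum_ord_nat natrM -subn1 natrB.
have E2 : (P + k * wfloor h k = h * \sum_(r < k) r ^ 2)%N.
  rewrite /P /wfloor !big_distrr -big_split /=; apply: eq_bigr => r _.
  by have := divn_eq (h * r) k; nia.
have E3 : (6 * (\sum_(r < k) r ^ 2)%N%:R = k%:R * (k%:R - 1) * (2 * k%:R - 1) :> R).
  by rewrite -natrM sum_ord_sq !natrM -subn1 -[(2 * k).-1]subn1 !natrB ?natrM //; lia.
have {}E2 : P%:R = h%:R * (\sum_(r < k) r ^ 2)%N%:R - k%:R * (wfloor h k)%:R :> R.
  by rewrite -[h%:R * _]natrM -E2 natrD natrM addrK.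
rewrite sumE E2 natrM /dedN.
transitivity ((2 * h%:R * (6 * (\sum_(r < k) r ^ 2)%N%:R)) / k%:R - 12 * (wfloor h k)%:R
   - 6 * (2 * S%:R) + 3 * k%:R ^+ 2 - 3 * k%:R : R); first by field.
rewrite E3 E1 !(intrB, intrM) /intmul /=.
by field.
Qed.

Lemma dedekind_sum_congr (g h k : nat) : (0 < k)%N -> coprime h k ->
  g = h %[mod k] -> dedekind_sum g k = dedekind_sum h k :> R.
Proof.
move=> k0 co E; rewrite !dedekind_sum_nat //; last first.
  by rewrite -coprime_modl E coprime_modl.
by congr (_ - _); apply: eq_bigr => r _; rewrite -(modnMml g) E modnMml.
Qed.

End DedekindSums.

(** * The eta multiplier and its change of level *)

Lemma coprime6_odd d : coprime d 6 -> odd d.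
Proof. by rewrite (@coprimeMr d 2 3) coprimen2 => /andP[]. Qed.

(** Multiply the reciprocity law by the inverse [a] of [d]; the term [c * dedN c d] is needed only
    modulo [24 c], so knowing [dedN c d] modulo 24 suffices. *)
Lemma dedN_mod (a c d : nat) : (0 < c)%N -> coprime d (6 * c)%N ->
  (a * d = 1 %[mod 24 * c])%N -> exists z : int,
  dedN d c = a%:Z + d%:Z + a%:Z * c%:Z ^+ 2 - 3 * a%:Z * c%:Z
    - 12 * c%:Z * (jac c d)%:Z + 24 * c%:Z * z.
Proof.
move=> c0; rewrite coprimeMr => /andP[d6 dc] ad.
have od := coprime6_odd d6.
have d3 : ~~ (3 %| d)%N.
  by rewrite -prime_coprime // coprime_sym; move: d6; rewrite (@coprimeMr d 2 3) => /andP[].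
(* Chinese remainders: 9 is 1 modulo 8 and 0 modulo 3. *)
have [z Ez] : exists z : int, dedN c d = 9 * (d%:Z - 1 + 4 * (jac c d)%:Z) + 24 * z.
  have := dedN_mod8 c od; have := dedN_mod3 c d3.
  move: (dedN c d) (jac c d) => N j; case: j => /=.
    by exists ((N - 9 * (d%:Z - 1 + 4)) %/ 24)%Z; lia.
  by exists ((N - 9 * (d%:Z - 1)) %/ 24)%Z; lia.
have rec := dedN_reciprocity dc (odd_gt0 od) c0.
have adE : a%:Z * d%:Z = 1 + 24 * c%:Z * (a * d %/ (24 * c))%N%:Z.
  have := divn_eq (a * d)%N (24 * c)%N; rewrite ad modn_small; lia.
(* Oddness of [a] reduces [36 a c j] to [12 c j], and [12 a c] to [12 c], modulo [24 c]. *)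
have oa : odd a.
  have := congr1 odd (divn_eq (a * d)%N (24 * c)%N).
  by rewrite ad modn_small ?oddD ?oddM ?andbF /=; [case: (odd a)|lia].
have aE : a%:Z = 2 * a./2%:Z + 1 by lia.
move: rec adE aE; rewrite {}Ez; move: (dedN d c) (nat_of_bool _)%:Z (_ %/ _)%N%:Z a./2%:Z.
move=> N j m h rec adE aE.
exists (m * d%:Z - 12 * c%:Z * m + h - j * (3 * h + 1) - a%:Z * z - m * N).
transitivity (N * (a%:Z * d%:Z) - N * (24 * c%:Z * m)); first by rewrite adE; ring.
transitivity (a%:Z * (d%:Z * N + c%:Z * (9 * (d%:Z - 1 + 4 * j) + 24 * z))
   - a%:Z * (c%:Z * (9 * (d%:Z - 1 + 4 * j) + 24 * z)) - N * (24 * c%:Z * m)); first by ring.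
rewrite rec.
transitivity ((a%:Z * d%:Z) * (d%:Z - 12 * c%:Z) + a%:Z * c%:Z ^+ 2 + a%:Z
   + 9 * a%:Z * c%:Z - 36 * a%:Z * c%:Z * j - 24 * a%:Z * c%:Z * z
   - N * (24 * c%:Z * m)); first by ring.
by rewrite adE aE; ring.
Qed.

Section Omega.
Variable R : realType.

Definition omega (d c : nat) : R[i] := expi (- (pi * dedekind_sum d c)).

Lemma omega_congr (g h k : nat) : (0 < k)%N -> coprime h k ->
  g = h %[mod k] -> omega g k = omega h k.
Proof. by move=> *; rewrite /omega (@dedekind_sum_congr _ g h). Qed.

(* The multiplier system of the Dedekind eta function, with [jac c d] as the
   Jacobi symbol. *)
Lemma omegaE (a c d : nat) : (0 < c)%N -> coprime d (6 * c)%N ->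
  (a * d = 1 %[mod 24 * c])%N ->
  omega d c = (-1) ^+ jac c d *
    e2pi (- ((a + d)%:R / (24 * c%:R)) - (a * c)%:R / 24 + a%:R / 8).
Proof.
move=> c0 d6c ad.
have [z Ez] := dedN_mod c0 d6c ad.
have dc : coprime d c by move: d6c; rewrite coprimeMr => /andP[].
have cR : (c%:R : R) != 0 by rewrite pnatr_eq0 -lt0n.
have s2 : - (pi * dedekind_sum d c) = 2 * pi * (- ((dedN d c)%:~R / (24 * c%:R))) :> R.
  by rewrite -dedekind_sumE // natrM; field.
rewrite /omega s2 -/(e2pi _) -e2pi_half -e2piD; apply: (@e2pi_congr _ (- z)).
rewrite Ez !(intrD, intrB, intrM, intrN, mulrNz, natrD, natrM) -!pmulrn.
by field.
Qed.

(** The same [a] serves at both levels, so [omegaE] can be divided by itself: the symbol of [k] and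
    the term [a / 8] cancel. *)
Lemma omega_mul (p a k d : nat) : (0 < k)%N -> (0 < p)%N -> coprime d (6 * (p * k))%N ->
  (a * d = 1 %[mod 24 * (p * k)])%N ->
  omega d (p * k)%N = omega d k * (-1) ^+ jac p d *
    e2pi ((p%:R - 1) * ((a + d)%:R / (24 * p%:R * k%:R)) - (p%:R - 1) * (a * k)%:R / 24).
Proof.
move=> k0 p0 co ad.
have cop : coprime d (6 * k)%N by move: co; rewrite !coprimeMr => /and3P[-> _ ->].
have codp : coprime d p by move: co; rewrite !coprimeMr => /and3P[].
have codk : coprime d k by move: co; rewrite !coprimeMr => /and3P[].
have od : odd d by move: co; rewrite coprimeMr => /andP[/coprime6_odd].
have ad' : (a * d = 1 %[mod 24 * k])%N.
  by rewrite -(modn_dvdm (a * d)%N (_ : 24 * k %| 24 * (p * k))%N) ?ad ?modn_dvdm //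
    ?dvdn_pmul2l // dvdn_mull.
rewrite (omegaE _ co ad) ?muln_gt0 ?p0 // (omegaE k0 cop ad').
rewrite jacM // 1?coprime_sym // signr_addb.
have kR : (k%:R : R) != 0 by rewrite pnatr_eq0 -lt0n.
have pR : (p%:R : R) != 0 by rewrite pnatr_eq0 -lt0n.
rewrite [_ * (-1) ^+ jac k d]mulrC -!mulrA; congr (_ * _).
rewrite mulrCA; congr (_ * _); rewrite -e2piD; congr e2pi.
by rewrite !(natrM, natrD); field; rewrite kR pR.
Qed.

End Omega.

(** * Summation over fibres *)

Definition modn_fun (V : Type) (m : nat) (F : nat -> V) :=
  forall d e, (d = e %[mod m])%N -> F d = F e.

Section Resummation.
Variables (V : nmodType) (F : nat -> V).

Lemma sum_ord_mul (p k : nat) :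
  \sum_(d < p * k) F d = \sum_(d < k) \sum_(j < p) F (d + k * j)%N.
Proof.
rewrite exchange_big /=; elim: p => [|p IH]; first by rewrite mul0n !big_ord0.
rewrite big_ord_recr /= -IH -[LHS](big_mkord xpredT) mulSn addnC.
rewrite (@big_cat_nat _ _ _ (p * k)%N) ?leq_addr //= big_mkord; congr (_ + _).
rewrite -{1}[(p * k)%N]add0n big_addn addKn big_mkord.
by apply: eq_bigr => i _; rewrite mulnC.
Qed.

Lemma sum_ord_affine (p t u : nat) : modn_fun p F -> coprime u p ->
  \sum_(j < p) F (t + u * j)%N = \sum_(j < p) F j.
Proof.
move=> per co; rewrite -(sum_modn_reindex F co).
case: p per co => [|p] per co; first by rewrite !big_ord0.
have E : \sum_(j < p.+1) F (t + u * j)%N = \sum_(j < p.+1) F (t + u * j %% p.+1)%N.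
  by apply: eq_bigr => j _; apply: per; rewrite modnDmr.
rewrite {}E (sum_modn_reindex (fun x => F (t + x)%N) co) (sum_modn_reindex F co).
elim: t => [|t IH]; first by apply: eq_bigr.
rewrite -IH [RHS]big_ord_recl [LHS]big_ord_recr [LHS]addrC /=; congr (_ + _).
  by apply: per; rewrite addn0 addSnnS modnDr.
by apply: eq_bigr => i _; congr F; rewrite /bump /=; lia.
Qed.

End Resummation.

Section Fibers.
Variables (V : nmodType) (F : nat -> V) (p k : nat).
Hypotheses (p0 : (0 < p)%N) (k0 : (0 < k)%N) (per : modn_fun (p * k)%N F).

Definition fiber_sum (d : nat) : V := \sum_(j < p) F (d + k * j)%N.

Lemma modn_fun_fiber d : modn_fun p (fun j => F (d + k * j)%N).
Proof.
move=> i j ij /=; apply: per; apply/eqP; rewrite eqn_modDl mulnC (mulnC k).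
by rewrite -!muln_modl ij.
Qed.

Lemma fiber_sum_dilate u d : coprime u p ->
  fiber_sum d = \sum_(j < p) F (d + k * (u * j))%N.
Proof.
move=> co; rewrite /fiber_sum -(sum_ord_affine 0 (modn_fun_fiber d) co).
exact: eq_bigr.
Qed.

Lemma fiber_sum_congr : modn_fun k fiber_sum.
Proof.
move=> d e; wlog le : d e / (e <= d)%N.
  by move=> H; case/orP: (leq_total e d) => l E; [|apply/esym]; apply: H.
move/eqP; rewrite eqn_mod_dvd // => /dvdnP[t E].
have {E} -> : (d = e + k * t)%N by lia.
rewrite /fiber_sum -(sum_ord_affine t (modn_fun_fiber e) (coprime1n p)).
by apply: eq_bigr => j _; congr F; lia.
Qed.

Lemma sum_fiber : \sum_(d < p * k) F d = \sum_(d < k) fiber_sum d.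
Proof. exact: sum_ord_mul. Qed.

Lemma sum_fiber_dilate : coprime p k ->
  \sum_(d < p * k) F d = \sum_(d < k) fiber_sum (p * d)%N.
Proof.
move=> co; rewrite sum_fiber -(sum_modn_reindex fiber_sum co).
by apply: eq_bigr => d _; apply: fiber_sum_congr; rewrite modn_mod.
Qed.

End Fibers.

Lemma coprime6_lift (k d : nat) : (0 < k)%N -> coprime d k ->
  exists2 D, (D = d %[mod k])%N & coprime D (6 * k)%N.
Proof.
move=> k0 co.
have common q : q != 1%N -> (q %| d)%N -> (q %| k)%N -> False.
  by move=> q1 qd qk; have := dvdn_gcd q d k; rewrite qd qk (eqP co) dvdn1 (negPf q1).
have := common 2 isT; have := common 3 isT; move=> c3 c2.
have cop6 x : coprime x 6 = odd x && ~~ (3 %| x)%N.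
  by rewrite (@coprimeMr x 2 3) coprimen2 (coprime_sym x 3) prime_coprime.
have [t Ht] : exists t, coprime (d + t * k)%N 6.
  (* If [d] is even then [k] is odd, and [3 k] changes the parity but not the residue modulo 3. If 3
     divides [d] it does not divide [k], and [4 k] does the opposite. *)
  exists (3 * ~~ odd d + 4 * (3 %| d))%N; rewrite cop6.
  by case d2: (odd d); case d3: (3 %| d)%N; lia.
exists (d + t * k)%N; first by rewrite addnC modnMDl.
by rewrite coprimeMr Ht -coprime_modl addnC modnMDl coprime_modl.
Qed.

(** * Formal sums of roots of unity *)

(* Formal sums of monomials [c * X ^ e], later evaluated at a p-th root of unity. *)
Definition fsum := seq (int * nat).

Definition fmul (a b : fsum) : fsum :=
  [seq (x.1 * y.1, (x.2 + y.2)%N) | x <- a, y <- b].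

Definition fcoef (p r : nat) (a : fsum) : int :=
  foldr (fun x s => if (x.2 %% p == r)%N then x.1 + s else s) 0 a.

(* Sums of length at most [p], to keep the final computations small. *)
Definition freduce (p : nat) (a : fsum) : fsum := [seq (fcoef p r a, r) | r <- iota 0 p].

(** Equal coefficients make the value a multiple of the sum of all [p]-th roots of unity, which is
    0. *)
Definition fvanish (p : nat) (a : fsum) : bool :=
  all (fun r => fcoef p r a == fcoef p 0 a) (iota 0 p).

(* [(X ^ m - X ^ - m) * fsum_inv p m] evaluates to [p]. *)
Definition fsum_inv (p m : nat) : fsum := [seq (Posz j, (m + 2 * m * j)%N) | j <- iota 0 p].

Section Evaluation.
Variables (R : realType) (p : nat).
Hypotheses (p_pr : prime p) (p_gt2 : (2 < p)%N).

Definition zeta : R[i] := e2pi (1 / p%:R).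

Definition feval (a : fsum) : R[i] := \sum_(x <- a) x.1%:~R * zeta ^+ x.2.

Let pR : (p%:R : R) != 0.
Proof. by rewrite pnatr_eq0 -lt0n prime_gt0. Qed.

Lemma zetaX n : zeta ^+ n = e2pi (n%:R / p%:R).
Proof. by rewrite -e2piMn mul1r mulrC. Qed.

Lemma zetap : zeta ^+ p = 1.
Proof. by rewrite zetaX divff // (e2pi_int R 1). Qed.

Lemma zeta_mod m n : (m = n %[mod p])%N -> zeta ^+ m = zeta ^+ n.
Proof.
by move=> E; rewrite (divn_eq m p) (divn_eq n p) E !exprD !(mulnC _ p) !exprM zetap !expr1n.
Qed.

(** By Bezout, [zeta ^+ m = 1] would give [zeta = 1], but [0 < 2 pi / p < pi] makes its imaginary
    part positive. *)
Lemma zeta_neq1 m : ~~ (p %| m)%N -> zeta ^+ m != 1.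
Proof.
move=> pm; apply/eqP => zm1.
have [|u v uv _] := @egcdnP m p; first by rewrite lt0n; apply: contraNneq pm => ->.
have z1 : zeta = 1.
  have /eqP g1 : coprime m p by rewrite coprime_sym prime_coprime.
  have : zeta ^+ (u * m) = zeta ^+ (v * p + gcdn m p) by rewrite uv.
  by rewrite g1 exprD expr1 mulnC exprM zm1 mulnC exprM zetap !expr1n mul1r => <-.
have : 0 < sin (2 * pi * (1 / p%:R)) :> R.
  have pi0 := pi_gt0 R; have p2 : (2 : R) < p%:R by rewrite ltr_nat.
  have p0 : (0 : R) < p%:R by rewrite (lt_trans _ p2).
  apply: sin_gt0_pi; rewrite !mulr_gt0 ?div1r ?invr_gt0 //=.
  by rewrite ltr_pdivrMr // mulrC ltr_pM2l.
by move: z1; rewrite /zeta /e2pi /expi => -[_ ->]; rewrite ltxx.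
Qed.

Lemma sum_zeta m : ~~ (p %| m)%N -> \sum_(j < p) zeta ^+ (m * j) = 0.
Proof.
move=> /zeta_neq1 z1; apply: (mulfI (_ : zeta ^+ m - 1 != 0)); first by rewrite subr_eq0.
rewrite mulr0 (eq_bigr (fun j : 'I_p => (zeta ^+ m) ^+ j)); last by move=> j _; rewrite exprM.
by rewrite -subrX1 -exprM mulnC exprM zetap expr1n subrr.
Qed.

Lemma feval_cat a b : feval (a ++ b) = feval a + feval b.
Proof. by rewrite /feval big_cat. Qed.

Lemma feval_seq1 c e : feval [:: (c, e)] = c%:~R * zeta ^+ e.
Proof. by rewrite /feval big_seq1. Qed.

Lemma feval_mul a b : feval (fmul a b) = feval a * feval b.
Proof.
rewrite /feval /fmul big_allpairs_dep mulr_suml; apply: eq_bigr => x _.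
by rewrite mulr_sumr; apply: eq_bigr => y _; rewrite intrM exprD mulrACA.
Qed.

Lemma feval_flatten (T : Type) (s : seq T) (f : T -> fsum) :
  feval (flatten [seq f x | x <- s]) = \sum_(x <- s) feval (f x).
Proof. by rewrite /feval big_flatten big_map. Qed.

Lemma feval_coef a : feval a = \sum_(r < p) (fcoef p r a)%:~R * zeta ^+ r.
Proof.
rewrite /feval; elim: a => [|x a IH].
  by rewrite big_nil big1 // => r _; rewrite mul0r.
have p0 := prime_gt0 p_pr.
rewrite big_cons IH /= [in RHS](bigD1 (Ordinal (ltn_pmod x.2 p0))) //= eqxx.
rewrite [X in _ + X](bigD1 (Ordinal (ltn_pmod x.2 p0))) //= intrD mulrDl -addrA.
rewrite (@zeta_mod (x.2 %% p) x.2) ?modn_mod //; congr (_ + (_ + _)).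
apply: eq_bigr => r rx; case: eqP => // E; case/eqP: rx.
by apply/val_inj => /=; rewrite E.
Qed.

Lemma feval_reduce a : feval (freduce p a) = feval a.
Proof.
by rewrite [RHS]feval_coef /feval big_map -{1}(subn0 p) -/(index_iota 0 p) big_mkord.
Qed.

Lemma fvanishP a : fvanish p a -> feval a = 0.
Proof.
move=> /allP H; rewrite feval_coef.
rewrite (eq_bigr (fun r : 'I_p => (fcoef p 0 a)%:~R * zeta ^+ (1 * r))).
  rewrite -mulr_sumr sum_zeta ?mulr0 // Euclid_dvd1 //.
by move=> r _; rewrite mul1n (eqP (H r _)) // mem_iota /= ltn_ord.
Qed.

(** Taken at even multiples of [pi / p], so that up to the factor [2 i] it is a difference of powers
    of [zeta]. *)
Definition sinC (m : nat) : R[i] := (sin (2 * pi * (m%:R / p%:R)))%:C.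

Lemma sinCE m : sinC m = (zeta ^+ m - zeta ^+ (p.-1 * m)) / (2 * 'i).
Proof.
rewrite /sinC sin_expi -mulrN -!/(e2pi _) !zetaX; congr ((_ - _) / _).
apply: (@e2pi_congr _ (- Posz m)); rewrite natrM -subn1 natrB ?prime_gt0 // mulrNz -pmulrn.
by field.
Qed.

(** With [z = zeta ^+ (2 * m)], the inverse is [2 i zeta ^+ m / (z - 1)], and summation by parts
    gives [(z - 1) * sum j z^j = p]. *)
Lemma sinC_inv m : ~~ (p %| m)%N -> (sinC m)^-1 = 2 * 'i / p%:R * feval (fsum_inv p m).
Proof.
move=> pm; have pC : (p%:R : R[i]) != 0 by rewrite pnatr_eq0 -lt0n prime_gt0.
have i0 : (2 * 'i : R[i]) != 0 by rewrite mulf_neq0 ?pnatr_eq0 ?neq0Ci.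
set z := zeta ^+ (2 * m).
have z1 : z != 1.
  by apply: zeta_neq1; rewrite Euclid_dvdM // negb_or pm andbT gtnNdvd.
have zp : z ^+ p = 1 by rewrite -exprM mulnC exprM zetap expr1n.
have zm0 : zeta ^+ m != 0 by rewrite expf_neq0 // e2pi_neq0.
have fE : feval (fsum_inv p m) = zeta ^+ m * \sum_(j < p) j%:R * z ^+ j.
  rewrite /feval big_map -{1}(subn0 p) -/(index_iota 0 p) big_mkord mulr_sumr.
  by apply: eq_bigr => j _ /=; rewrite -pmulrn exprD -exprM mulrCA.
have geo : (z - 1) * (\sum_(j < p) j%:R * z ^+ j) = p%:R.
  have sumz q : (z - 1) * (\sum_(j < q) j%:R * z ^+ j)
      = q%:R * z ^+ q - \sum_(j < q) z ^+ j.+1.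
    elim: q => [|q IH]; first by rewrite !big_ord0 mulr0 mul0r subrr.
    by rewrite !big_ord_recr /= mulrDr IH !exprS -natr1; ring.
  rewrite sumz zp mulr1 (eq_bigr (fun j : 'I_p => z * zeta ^+ (2 * m * j))).
    rewrite -mulr_sumr sum_zeta ?mulr0 ?subr0 //.
    by rewrite Euclid_dvdM // negb_or pm andbT gtnNdvd.
  by move=> j _; rewrite exprS exprM.
have sE : sinC m * (2 * 'i) * zeta ^+ m = z - 1.
  rewrite sinCE divfK // mulrBl -!exprD addnn -mul2n; congr (_ - _).
  by rewrite -mulSnr prednK ?prime_gt0 // exprM zetap expr1n.
have s0 : sinC m != 0.
  by apply/eqP => E; move: sE; rewrite E !mul0r => /esym/eqP; rewrite subr_eq0 (negPf z1).
apply: (mulfI s0); rewrite divff // fE.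
rewrite [RHS](_ : _ = (sinC m * (2 * 'i) * zeta ^+ m)
   * (\sum_(j < p) j%:R * z ^+ j) / p%:R); last by ring.
by rewrite sE geo divff.
Qed.

End Evaluation.

(** * The summands of the Kloosterman sums *)

Lemma modn1_coprime a d m : (a * d = 1 %[mod m])%N -> coprime d m.
Proof.
move=> E; have : coprime (a * d) m by rewrite -coprime_modl E coprime_modl coprime1n.
by rewrite coprimeMl => /andP[].
Qed.

Lemma modn1_odd a d m : (a * d = 1 %[mod 24 * m])%N -> odd d.
Proof.
by move/modn1_coprime; rewrite coprimeMr (@coprimeMr d 2 12) coprimen2 => /andP[/andP[]].
Qed.

Lemma modn_dvd_congr m n a b : (m %| n)%N -> (a = b %[mod n])%N -> (a = b %[mod m])%N.
Proof. by move=> mn E; rewrite -(modn_dvdm a mn) E modn_dvdm. Qed.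

Lemma modn_inverse d m : (0 < m)%N -> coprime d m -> exists a, (a * d = 1 %[mod m])%N.
Proof.
move=> m0 co; exists (d ^ (totient m).-1)%N.
by rewrite -expnSr prednK ?totient_gt0 // Euler_exp_totient.
Qed.

Section Terms.
Variable R : realType.

Lemma sin_shift (x : R) m : sin (x + pi * m%:R) = (-1) ^+ m * sin x.
Proof.
elim: m => [|m IH]; first by rewrite mulr0 addr0 mul1r.
by rewrite -natr1 mulrDr mulr1 addrA sinDpi IH exprS mulN1r mulNr.
Qed.

Lemma natr_half N : ~~ odd N -> (N./2)%:R = N%:R / 2 :> R.
Proof.
by move=> e; rewrite -[in RHS](even_halfK e) -mul2n natrM mulrC mulKf ?pnatr_eq0.
Qed.

Lemma div_sign (x s : R[i]) m : (-1) ^+ m * x / ((-1) ^+ m * s) = x / s.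
Proof. by rewrite invfM invr_sign mulrACA -expr2 sqrr_sign mul1r. Qed.

Lemma complex_sign (x : R) m : ((-1) ^+ m * x)%:C = (-1) ^+ m * x%:C.
Proof.
rewrite -signr_odd -[in RHS]signr_odd; case: odd; rewrite ?expr0 ?mul1r // !expr1.
by rewrite !mulN1r; apply/eqP; rewrite eq_complex /= oppr0 !eqxx.
Qed.

Definition kterm (p l n c d a : nat) : R[i] :=
  (-1) ^+ (l * c) * e2pi (- ((3 * c * a * l ^ 2)%N%:R / (2 * p ^ 2)%N%:R))
    / (sin (pi * (a * l)%N%:R / p%:R))%:C
  * omega R d c * e2pi (n%:R * d%:R / c%:R).

(** Empty when [d] is not prime to [c]; the outer sum can thus run over all [d], as splitting into
    fibres requires. *)
Definition ksum (p l n c d : nat) : R[i] :=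
  \sum_(a < c | (a * d == 1 %[mod c])%N) kterm p l n c d a.

Lemma S_inf_infE p l (n c : nat) :
  S_inf_inf p l n c = e2pi (- (1 / 8)) * \sum_(d < c) ksum p l n c d.
Proof.
rewrite /S_inf_inf; congr (_ * _); rewrite big_mkcond; apply: eq_bigr => d _ /=.
case: ifP => // /negP co; rewrite /ksum big1 // => a /eqP E.
by case: co; exact: modn1_coprime E.
Qed.

Section Level.
Variables (p k : nat).
Hypotheses (p_pr : prime p) (p_gt3 : (3 < p)%N) (k0 : (0 < k)%N).
Let p0 : (0 < p)%N. Proof. exact: prime_gt0. Qed.
Let pR : (p%:R : R) != 0. Proof. by rewrite pnatr_eq0 -lt0n. Qed.
Let kR : (k%:R : R) != 0. Proof. by rewrite pnatr_eq0 -lt0n. Qed.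
Let oddp : odd p. Proof. by case: (even_prime p_pr) p_gt3 => [->|]. Qed.
Let c0 : (0 < p * k)%N. Proof. by rewrite muln_gt0 p0. Qed.

(** The sine and the half-integral phase both change by the sign [(-1)^(q k l)], which cancels in
    the quotient. *)
Lemma kterm_shift l n d a q :
  kterm p l n (p * k) d (a + p * k * q) = kterm p l n (p * k) d a.
Proof.
rewrite /kterm; congr (_ * _ * _).
have -> : pi * ((a + p * k * q) * l)%N%:R / p%:R
    = pi * (a * l)%N%:R / p%:R + pi * (q * k * l)%N%:R :> R.
  by rewrite !(natrM, natrD); field.
rewrite sin_shift complex_sign -!mulrA; congr (_ * _).
have even : ~~ odd (q * k * l * (3 * k * l + 1))%N.
  by rewrite !(oddM, oddD) /=; case: (odd q); case: (odd k); case: (odd l).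
rewrite -[RHS](div_sign _ _ (q * k * l)) -e2pi_half -e2piD; congr (_ / _).
apply: (@e2pi_congr _ (- Posz (q * k * l * (3 * k * l + 1))./2)).
rewrite mulrNz -pmulrn.
rewrite (natr_half even).
by rewrite !(natrM, natrD, natrX); field.
Qed.

Lemma ksum_eval l n d a : (a * d = 1 %[mod p * k])%N ->
  ksum p l n (p * k) d = kterm p l n (p * k) d a.
Proof.
move=> ad; rewrite {1}(divn_eq a (p * k)) addnC [(_ %/ _ * _)%N]mulnC kterm_shift /ksum.
rewrite (big_pred1 (Ordinal (ltn_pmod a c0))) // => x /=.
apply/idP/eqP => [xd|->]; last by rewrite modnMml ad.
apply/val_inj => /=; rewrite -(modn_small (ltn_ord x)).
rewrite -[LHS]/(x %% _)%N -(muln1 x) -modnMmr -ad modnMmr mulnCA -modnMmr (eqP xd) modnMmr.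
by rewrite muln1.
Qed.

Lemma ksum_eq0 l n d : ~~ coprime d (p * k) -> ksum p l n (p * k) d = 0.
Proof.
move=> /negP co; rewrite /ksum big_pred0 // => a; apply/eqP => E.
by case: co; exact: modn1_coprime E.
Qed.

Lemma kterm_congr l n d e a : coprime e (p * k) -> (d = e %[mod p * k])%N ->
  kterm p l n (p * k) d a = kterm p l n (p * k) e a.
Proof.
move=> co E; rewrite /kterm (omega_congr _ _ co E) //; congr (_ * _).
wlog le : d e co E / (e <= d)%N.
  move=> H; case/orP: (leq_total e d) => l'; first exact: H.
  by apply/esym/H => //; rewrite -coprime_modl E coprime_modl.
move/eqP: E; rewrite eqn_mod_dvd // => /dvdnP[q Eq].
have -> : d = (e + q * (p * k))%N by lia.
apply: (@e2pi_congr _ (Posz (n * q))); rewrite -pmulrn !(natrM, natrD).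
by field; rewrite kR pR.
Qed.

Lemma ksum_modn l n : modn_fun (p * k)%N (ksum p l n (p * k)).
Proof.
move=> d e E; have [co|nco] := boolP (coprime e (p * k)).
  have [a ae] := modn_inverse c0 co.
  rewrite (@ksum_eval _ _ d a) ?(@ksum_eval _ _ e a) ?(kterm_congr _ _ _ co E) //.
  by rewrite -modnMmr E modnMmr.
rewrite !ksum_eq0 //; apply: contraNN nco => co.
by rewrite -coprime_modl -E coprime_modl.
Qed.

End Level.
End Terms.

Section Level.
Variables (R : realType) (p k : nat).
Hypotheses (p_pr : prime p) (p_gt3 : (3 < p)%N) (k0 : (0 < k)%N).
Let p0 : (0 < p)%N. Proof. exact: prime_gt0. Qed.
Let pR : (p%:R : R) != 0. Proof. by rewrite pnatr_eq0 -lt0n. Qed.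
Let kR : (k%:R : R) != 0. Proof. by rewrite pnatr_eq0 -lt0n. Qed.
Let oddp : odd p. Proof. by case: (even_prime p_pr) p_gt3 => [->|]. Qed.
Let c0 : (0 < p * k)%N. Proof. by rewrite muln_gt0 p0. Qed.

Lemma kterm_omega l n d a : (a * d = 1 %[mod 24 * (p * k)])%N ->
  kterm R p l n (p * k) d a =
    (-1) ^+ (l * k) * e2pi (- ((3 * k * a * l ^ 2)%N%:R / (2 * p%:R)))
    / (sin (pi * (a * l)%N%:R / p%:R))%:C
  * (omega R d k * (-1) ^+ jac p d *
     e2pi ((p%:R - 1) * ((a + d)%:R / (24 * p%:R * k%:R)) - (p%:R - 1) * (a * k)%:R / 24))
  * e2pi ((n * d)%:R / (p%:R * k%:R)).
Proof.
move=> ad; have co : coprime d (6 * (p * k)).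
  have := modn1_coprime ad; rewrite !coprimeMr (@coprimeMr d 4 6).
  by case/and3P => /andP[_ ->] -> ->.
rewrite /kterm (omega_mul R k0 p0 co ad) !natrM !mulrA.
congr (_ * e2pi _ / _ * _ * _ * _ * e2pi _).
  by rewrite -signr_odd !oddM oddp /= -oddM signr_odd.
by rewrite ?natrX; field.
Qed.

(** In a phase over [24 p k], the parts [p b], [p B] leave the denominator [24 k] and the parts
    [24 k w], [24 k v] leave [p]. So [v] and [w] survive only in the last factor. In [36 * p.-1] the
    factor [p.-1] stands for -1. *)
Lemma kterm_coprime l n b B v w d a :
  a = (p * b + 24 * k * w)%N -> d = (p * B + 24 * k * v)%N ->
  (a * d = 1 %[mod 24 * (p * k)])%N ->
  kterm R p l n (p * k) d a =
    omega R (p * B) k * e2pi ((p%:R - 1) * ((b + B)%:R / (24 * k%:R) - (p * b * k)%:R / 24)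
      + (n * B)%:R / k%:R) * (-1) ^+ l *
    ((-1) ^+ jac p d *
      zeta R p ^+ (p.-1 * (v + w) + 36 * p.-1 * k ^ 2 * w * l ^ 2 + 24 * n * v)
      / sinC R p (12 * k * w * l)).
Proof.
move=> aE dE ad; rewrite (kterm_omega _ _ ad).
have codk : coprime d k.
  have := modn1_coprime ad; rewrite !coprimeMr => /and3P[_ _ //].
have oB : omega R d k = omega R (p * B) k.
  by apply/esym/omega_congr => //; rewrite dE (mulnAC 24) addnC modnMDl.
have oa : odd a by apply: (@modn1_odd d _ (p * k)); rewrite mulnC.
have ob : odd b by move: oa; rewrite aE oddD !oddM oddp /= addbF.
have sE : sin (pi * (a * l)%N%:R / p%:R)
    = (-1) ^+ (b * l) * sin (2 * pi * ((12 * k * w * l)%:R / p%:R)) :> R.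
  by rewrite -sin_shift aE; congr sin; rewrite !(natrM, natrD); field.
have pE : p.-1%:R = p%:R - 1 :> R by rewrite -subn1 natrB.
have eE : e2pi (- ((3 * k * a * l ^ 2)%N%:R / (2 * p%:R)))
    * e2pi ((p%:R - 1) * ((a + d)%:R / (24 * p%:R * k%:R)) - (p%:R - 1) * (a * k)%:R / 24)
    * e2pi ((n * d)%:R / (p%:R * k%:R))
  = (-1) ^+ (3 * k * b * l ^ 2) * e2pi ((p%:R - 1) * ((b + B)%:R / (24 * k%:R) - (p * b * k)%:R
    / 24)
      + (n * B)%:R / k%:R) *
    zeta R p ^+ (p.-1 * (v + w) + 36 * p.-1 * k ^ 2 * w * l ^ 2 + 24 * n * v).
  rewrite zetaX -e2pi_half -!e2piD.
  apply: (@e2pi_congr _ (- Posz (3 * k * b * l ^ 2 + 36 * k ^ 2 * w * l ^ 2 + p.-1 * k ^ 2 * w))).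
  rewrite mulrNz -pmulrn aE dE !(natrM, natrD, natrX) pE.
  by field; rewrite kR pR.
move: eE; set E1 := e2pi _; set E2 := e2pi _; set E3 := e2pi _; set E4 := e2pi _ => eE.
rewrite sE complex_sign -/(sinC _ _ _) oB invfM invr_sign.
set si := (sinC _ _ _)^-1.
transitivity ((-1) ^+ (l * k) * (-1) ^+ (b * l) * (E1 * E2 * E3) * si
  * (omega R (p * B) k * (-1) ^+ jac p d)); first by ring.
(* As [b] is odd, the three exponents add up to [l] modulo 2, and no trace of [k] is left. *)
have sgn : (-1) ^+ (l * k) * (-1) ^+ (b * l) * (-1) ^+ (3 * k * b * l ^ 2) = (-1) ^+ l :> R[i].
  rewrite -!exprD -signr_odd -[RHS]signr_odd !oddD !oddM ?oddX ob /=.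
  by case: (odd l); case: (odd k).
by rewrite eE -sgn; ring.
Qed.

(** Now [a] modulo [p] is constant on the fibre, and so is the sine up to sign. The factor [p.+1./2]
    is the inverse of 2 modulo [p]; it moves the sine to an even multiple of [pi / p]. *)
Lemma kterm_dvd l n i j D d a0 a : (p %| k)%N ->
  a = (a0 + 24 * k * i)%N -> d = (D + 24 * k * j)%N ->
  (a * d = 1 %[mod 24 * (p * k)])%N ->
  kterm R p l n (p * k) d a =
    omega R D k * e2pi ((p%:R - 1) * ((a0 + D)%:R / (24 * p%:R * k%:R) - (a0 * k)%:R / 24)
      + (n * D)%:R / (p%:R * k%:R)) * (-1) ^+ l *
    ((-1) ^+ jac p d * zeta R p ^+ (p.-1 * (i + j) + 24 * n * j)
      / sinC R p (p.+1./2 * a0 * l)).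
Proof.
move=> /dvdnP[q kq] aE dE ad; rewrite (kterm_omega _ _ ad).
have kqR : k%:R = q%:R * p%:R :> R by rewrite kq natrM.
have qR : (q%:R : R) != 0 by move: kR; rewrite kqR mulf_eq0 negb_or => /andP[].
have codk : coprime d k.
  have := modn1_coprime ad; rewrite !coprimeMr => /and3P[_ _ //].
have oB : omega R d k = omega R D k.
  by apply/esym/omega_congr => //; rewrite dE mulnAC addnC modnMDl.
have oa : odd a by apply: (@modn1_odd d _ (p * k)); rewrite mulnC.
have ob : odd a0 by move: oa; rewrite aE oddD !oddM /= addbF.
have sE : sin (pi * (a * l)%N%:R / p%:R)
    = (-1) ^+ l * sin (2 * pi * ((p.+1./2 * a0 * l)%:R / p%:R)) :> R.
  have hE : p%:R + 1 = 2 * (p.+1./2)%:R :> R.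
    by rewrite natr1 -natrM mul2n even_halfK //= oddp.
  transitivity (sin (pi * (a0 * l)%N%:R / p%:R + pi * (24 * q * i * l)%N%:R) : R).
    by rewrite aE; congr sin; rewrite !(natrM, natrD) kqR; field.
  rewrite sin_shift (_ : 2 * pi * _ = pi * (a0 * l)%N%:R / p%:R + pi * (a0 * l)%N%:R); last first.
    rewrite !natrM; transitivity (pi * ((2 * (p.+1./2)%:R) * a0%:R * l%:R) / p%:R : R).
      by field.
    by rewrite -hE; field.
  rewrite sin_shift mulrA -exprD -signr_odd -[in RHS]signr_odd oddD !oddM ob /=.
  by rewrite addbb.
have pE : p.-1%:R = p%:R - 1 :> R by rewrite -subn1 natrB.
have eE : e2pi (- ((3 * k * a * l ^ 2)%N%:R / (2 * p%:R)))
    * e2pi ((p%:R - 1) * ((a + d)%:R / (24 * p%:R * k%:R)) - (p%:R - 1) * (a * k)%:R / 24)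
    * e2pi ((n * d)%:R / (p%:R * k%:R))
  = (-1) ^+ (3 * q * a0 * l ^ 2) * e2pi ((p%:R - 1) * ((a0 + D)%:R / (24 * p%:R * k%:R) - (a0 *
    k)%:R / 24)
      + (n * D)%:R / (p%:R * k%:R)) *
    zeta R p ^+ (p.-1 * (i + j) + 24 * n * j).
  rewrite zetaX -e2pi_half -!e2piD.
  apply: (@e2pi_congr _ (- Posz (3 * q * a0 * l ^ 2 + 36 * k * q * i * l ^ 2 + p.-1 * k ^ 2 * i))).
  rewrite mulrNz -pmulrn aE dE !(natrM, natrD, natrX) pE kqR.
  by field; rewrite qR pR.
move: eE; set E1 := e2pi _; set E2 := e2pi _; set E3 := e2pi _; set E4 := e2pi _ => eE.
rewrite sE complex_sign -/(sinC _ _ _) oB invfM invr_sign.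
set si := (sinC _ _ _)^-1.
transitivity ((-1) ^+ (l * k) * (-1) ^+ l * (E1 * E2 * E3) * si
  * (omega R D k * (-1) ^+ jac p d)); first by ring.
have sgn : (-1) ^+ (l * k) * (-1) ^+ l * (-1) ^+ (3 * q * a0 * l ^ 2) = (-1) ^+ l :> R[i].
  rewrite -!exprD -signr_odd -[RHS]signr_odd kq !oddD !oddM ?oddX ob oddp /=.
  by case: (odd l); case: (odd q).
by rewrite eE -[in RHS]sgn; ring.
Qed.

End Level.

(** * Contribution of a fibre *)

Lemma modn_Fp p x y : prime p -> (x%:R == y%:R :> 'F_p) = (x == y %[mod p])%N.
Proof. by move=> pp; rewrite -val_eqE /= !val_Fp_nat. Qed.

(* Inverse of [576 k ^ 2 v = (24 k) ^ 2 v] modulo [p], by Fermat. *)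
Definition winv (p k v : nat) : nat :=
  ((((576 %% p) * (k ^ 2 * v)) %% p) ^ p.-2 %% p)%N.

(* The fibre of [p B] modulo [k], for [p] prime to [k]: the summands are [d = p B + 24 k v]
   with inverse [a = p b + 24 k w], see [kterm_coprime]. *)
Definition block (p k l n : nat) : fsum :=
  flatten [seq (let w := winv p k v in
    fmul [:: ((-1 : int) ^+ jac (24 * k * v %% p)%N p,
             (p.-1 * (v + w) + (36 * p.-1 %% p) * ((k ^ 2 %% p) * (w * l ^ 2 %% p))
               + (24 * n %% p) * v)%N)]
      (fsum_inv p (12 * k * w * l %% p)%N)) | v <- iota 1 p.-1].

(* The fibre of [D] modulo [k], for [p %| k]: the summands are [d = D + 24 k j] with
   inverse [a + 24 k i], see [kterm_dvd]. *)
Definition block0 (p a l n : nat) : fsum :=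
  flatten [seq (let i := (p.-1 * a ^ 2 * j %% p)%N in
    fmul [:: (1, (p.-1 * (i + j) + (24 * n %% p) * j)%N)]
      (fsum_inv p (p.+1./2 * a * l %% p)%N)) | j <- iota 0 p].

Lemma coprime24 p : prime p -> (3 < p)%N -> coprime 24 p.
Proof.
move=> pp p3; rewrite coprime_sym prime_coprime // -[24%N]/(2 ^ 3 * 3)%N Euclid_dvdM //
  Euclid_dvdX //.
by rewrite !gtnNdvd // (ltn_trans _ p3).
Qed.

Lemma half_lt p : (3 < p)%N -> (0 < p.+1./2 < p)%N.
Proof. lia. Qed.

Section Level.
Variables (R : realType) (p k : nat).
Hypotheses (p_pr : prime p) (p_gt3 : (3 < p)%N) (k0 : (0 < k)%N).
Let p0 : (0 < p)%N. Proof. exact: prime_gt0. Qed.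
Let p2 : (2 < p)%N. Proof. exact: ltnW. Qed.
Let oddp : odd p. Proof. by case: (even_prime p_pr) p_gt3 => [->|]. Qed.
Let c0 : (0 < p * k)%N. Proof. by rewrite muln_gt0 p0. Qed.
Let cop24 : coprime 24 p.
Proof. exact: coprime24. Qed.

Lemma winvP v : coprime k p -> (0 < v < p)%N ->
  (winv p (k %% p)%N v * (576 * k ^ 2 * v) = 1 %[mod p])%N.
Proof.
move=> cok /andP[v0 vp].
have co : coprime (576 * k ^ 2 * v)%N p.
  by rewrite -[576%N]/(24 ^ 2)%N !coprimeMl ?coprimeXl ?cop24 ?cok //= coprime_sym prime_coprime
    // gtnNdvd.
have E : ((576 %% p) * ((k %% p) ^ 2 * v) = 576 * k ^ 2 * v %[mod p])%N.
  by apply/eqP; rewrite -modn_Fp // !(natrM, natrX) !Fp_nat_mod // mulrA.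
rewrite /winv E modnXm modnMml -expnSr.
have -> : p.-2.+1 = totient p by rewrite totient_prime //; lia.
exact: Euler_exp_totient.
Qed.

Lemma sinC_mod m n : (m = n %[mod p])%N -> sinC R p m = sinC R p n.
Proof.
by move=> E; rewrite !sinCE // (zeta_mod R p_pr E) (@zeta_mod R _ p_pr (p.-1 * m)%N (p.-1 *
  n)%N) // -modnMmr E modnMmr.
Qed.

Lemma ndvdn_lt m : (0 < m < p)%N -> ~~ (p %| m)%N.
Proof. by move=> /andP[m0 mp]; rewrite gtnNdvd. Qed.

(** Reciprocity turns the symbol of [p] modulo the varying [d] into that of [d] modulo the fixed
    [p]; the correction depends on [d] modulo 4 only and is constant on a fibre. *)
Lemma jac_symbol a d e f : (a * d = 1 %[mod 24 * (p * k)])%N ->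
  (d = e %[mod p])%N -> (d = f %[mod 4])%N ->
  jac p d = jac e p (+) ((p %% 4 == 3) && (f %% 4 == 3))%N.
Proof.
move=> ad dE d4; have co : coprime p d.
  by rewrite coprime_sym; have := modn1_coprime ad; rewrite !coprimeMr => /and3P[].
by rewrite -(jac_congr dE) -d4 -(jac_flip co oddp (modn1_odd ad)) addbC addbK.
Qed.

Definition kcoef (n b B : nat) : R[i] :=
  omega R (p * B)%N k * e2pi ((p%:R - 1) * ((b + B)%:R / (24 * k%:R) - (p * b * k)%:R / 24)
      + (n * B)%:R / k%:R) * (-1) ^+ ((p %% 4 == 3) && (p * B %% 4 == 3))%N.

Lemma fiber_coprime l n b B : coprime k p -> (0 < l < p)%N ->
  (b * (p ^ 2 * B) = 1 %[mod 24 * k])%N ->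
  fiber_sum (ksum R p l n (p * k)%N) p k (p * B)%N =
    kcoef n b B * (-1) ^+ l * (2 * 'i / p%:R * feval R p (block p (k %% p)%N l (n %% p)%N)).
Proof.
move=> cokp lp bB.
rewrite (fiber_sum_dilate (ksum_modn R p_pr p_gt3 k0 l n) _ cop24).
rewrite -[LHS](big_mkord xpredT (fun v => ksum R p l n (p * k)%N (p * B + k * (24 * v))%N)).
(* At [v = 0] the index [p B] is not prime to [p], so this term is 0. *)
rewrite big_ltn // ksum_eq0 ?add0r; last first.
  rewrite !muln0 addn0 coprimeMr negb_and coprime_sym prime_coprime // dvdn_mulr //.
rewrite feval_flatten /index_iota subn1 !mulr_sumr; apply: eq_big_seq => v.
rewrite mem_iota => /andP[v1 vp]; set w := winv _ _ _.
have vlt : (0 < v < p)%N by lia.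
have wE : (w * (576 * k ^ 2 * v) = 1 %[mod p])%N by apply: winvP.
set d := (p * B + k * (24 * v))%N.
have dE : d = (p * B + 24 * k * v)%N by rewrite /d; ring.
pose a := (p * b + 24 * k * w)%N.
(* Modulo [24 k] the product is [p ^ 2 b B], modulo [p] it is [576 k ^ 2 v w]; both are 1. *)
have ad : (a * d = 1 %[mod 24 * (p * k)])%N.
  rewrite (mulnC p) mulnA; apply/eqP; rewrite chinese_remainder; last first.
    by rewrite coprimeMl cop24.
  apply/andP; split; apply/eqP; rewrite /a dE.
    have e x y : (p * x + 24 * k * y = p * x %[mod 24 * k])%N by rewrite addnC mulnC modnMDl.
    by rewrite -modnMm !e modnMm -bB; congr (_ %% _)%N; ring.
  have e x y : (p * x + y = y %[mod p])%N by rewrite mulnC modnMDl.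
  by rewrite -modnMm !e modnMm -wE; congr (_ %% _)%N; ring.
rewrite (@ksum_eval R p k p_pr k0 l n d a); last first.
  by apply: modn_dvd_congr ad; rewrite dvdn_mull.
rewrite (kterm_coprime R p_pr p_gt3 k0 l n (erefl a) dE ad).
have jE : jac p d = jac (24 * (k %% p) * v %% p)%N p (+) ((p %% 4 == 3) && (p * B %% 4 == 3))%N.
  apply: jac_symbol ad _ _.
    rewrite modn_mod dE mulnC modnMDl; apply/eqP.
    by rewrite -modn_Fp // !natrM Fp_nat_mod.
  have E4 : (24 * k * v = 4 * (6 * k * v))%N by rewrite !mulnA.
  by rewrite dE E4 [(4 * _)%N]mulnC addnC modnMDl.
rewrite jE signr_addb.
have zE : zeta R p ^+ (p.-1 * (v + w) + 36 * p.-1 * k ^ 2 * w * l ^ 2 + 24 * n * v)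
  = zeta R p ^+ (p.-1 * (v + w) + (36 * p.-1 %% p) * (((k %% p) ^ 2 %% p) * (w * l ^ 2 %% p))
               + (24 * (n %% p) %% p) * v)%N.
  apply: zeta_mod => //; apply/eqP; rewrite -modn_Fp // !(natrM, natrX, natrD, Fp_nat_mod p_pr).
  by apply/eqP; ring.
have sE : sinC R p (12 * k * w * l) = sinC R p (12 * (k %% p) * w * l %% p)%N.
  apply: sinC_mod; rewrite modn_mod; apply/eqP.
  by rewrite -modn_Fp // !natrM !Fp_nat_mod.
rewrite zE sE sinC_inv //; last first.
  rewrite /dvdn modn_mod -/(dvdn _ _) -prime_coprime // coprime_sym.
  have cow : coprime w p by rewrite mulnC in wE; exact: modn1_coprime wE.
  have cop12 : coprime 12 p by move: cop24; rewrite (@coprimeMl p 2 12) => /andP[].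
  rewrite !coprimeMl coprime_modl cokp cow cop12 /=.
  by rewrite coprime_sym prime_coprime // ndvdn_lt.
rewrite feval_mul feval_seq1 /kcoef.
set A := feval _ _ _; set Z := zeta R p ^+ _.
rewrite rmorph_sign; ring.
Qed.

Definition kcoef0 (n a D : nat) : R[i] :=
  omega R D k * e2pi ((p%:R - 1) * ((a + D)%:R / (24 * p%:R * k%:R) - (a * k)%:R / 24)
      + (n * D)%:R / (p%:R * k%:R)) * (-1) ^+ jac p D.

Lemma fiber_dvd l n D a0 : (p %| k)%N -> (0 < l < p)%N ->
  (a0 * D = 1 %[mod 24 * (p * k)])%N ->
  fiber_sum (ksum R p l n (p * k)%N) p k D =
    kcoef0 n a0 D * (-1) ^+ l * (2 * 'i / p%:R * feval R p (block0 p (a0 %% p)%N l (n %% p)%N)).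
Proof.
move=> pk lp ad0.
have [q kq] := dvdnP pk.
rewrite (fiber_sum_dilate (ksum_modn R p_pr p_gt3 k0 l n) _ cop24).
rewrite -[LHS](big_mkord xpredT (fun v => ksum R p l n (p * k)%N (D + k * (24 * v))%N)).
rewrite feval_flatten /index_iota subn0 !mulr_sumr; apply: eq_big_seq => j _.
set i := (p.-1 * _ * _ %% _)%N.
set d := (D + k * (24 * j))%N.
have dE : d = (D + 24 * k * j)%N by rewrite /d; ring.
pose a := (a0 + 24 * k * i)%N.
have adp : (a0 * D = 1 %[mod p])%N.
  by apply: modn_dvd_congr ad0; rewrite dvdn_mull // dvdn_mulr.
have p1 : p.-1%:R = -1 :> 'F_p.
  by rewrite -subn1 natrB // char_Fp_0 // sub0r.
have ad : (a * d = 1 %[mod 24 * (p * k)])%N.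
  (* The term linear in [24 k] is [i D + a0 j]; it vanishes modulo [p] for [i = - a0 ^ 2 j], because
     [a0 D = 1]. The term quadratic in [24 k] is harmless as [p] divides [k]. *)
  have /dvdnP[t Et] : (p %| i * D + a0 * j)%N.
    rewrite /dvdn -(mod0n p) -modn_Fp // /i !(natrD, natrM, natrX, Fp_nat_mod p_pr) p1.
    have adF : a0%:R * D%:R = 1 :> 'F_p.
      by apply/eqP; rewrite -natrM (modn_Fp _ 1) // adp.
    transitivity ((a0%:R * j%:R) * (1 - a0%:R * D%:R) == 0 :> 'F_p); last first.
      by rewrite adF subrr mulr0.
    by congr (_ == _); ring.
  have -> : (a * d = (t + 24 * q * i * j) * (24 * (p * k)) + a0 * D)%N.
    transitivity (24 * k * (i * D + a0 * j) + 24 * k * (24 * k) * i * j + a0 * D)%N.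
      by rewrite /a dE; ring.
    by rewrite Et kq; ring.
  by rewrite modnMDl.
rewrite (@ksum_eval R p k p_pr k0 l n d a); last first.
  by apply: modn_dvd_congr ad; rewrite dvdn_mull.
rewrite (kterm_dvd R p_pr p_gt3 k0 l n pk (erefl a) dE ad).
have jE : jac p d = jac p D.
  rewrite (jac_symbol ad0 erefl erefl); apply: jac_symbol ad _ _.
    by rewrite dE kq addnC (_ : 24 * (q * p) * j = 24 * q * j * p)%N ?modnMDl //; ring.
  have E4 : (24 * k * j = 4 * (6 * k * j))%N by rewrite !mulnA.
  by rewrite dE E4 [(4 * _)%N]mulnC addnC modnMDl.
have zE : zeta R p ^+ (p.-1 * (i + j) + 24 * n * j)
  = zeta R p ^+ (p.-1 * (i + j) + (24 * (n %% p) %% p) * j)%N.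
  apply: zeta_mod => //; apply/eqP; rewrite -modn_Fp // !(natrM, natrX, natrD, Fp_nat_mod p_pr).
  by apply/eqP; ring.
have sE : sinC R p (p.+1./2 * a0 * l) = sinC R p (p.+1./2 * (a0 %% p) * l %% p)%N.
  apply: sinC_mod; rewrite modn_mod; apply/eqP.
  by rewrite -modn_Fp // !natrM !Fp_nat_mod.
rewrite jE zE sE sinC_inv //; last first.
  rewrite /dvdn modn_mod -/(dvdn _ _) -prime_coprime // coprime_sym.
  have coa : coprime a0 p by rewrite mulnC in adp; exact: modn1_coprime adp.
  rewrite !coprimeMl coprime_modl coa !(coprime_sym _ p) !prime_coprime //.
  by rewrite (ndvdn_lt (half_lt p_gt3)) ndvdn_lt.
rewrite feval_mul feval_seq1 /kcoef0.
by rewrite mul1r; ring.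
Qed.
End Level.

(** * Expansion of Kloosterman sums into fibre blocks *)

Section Expansions.
Variable R : realType.

(** The point is that [Q] does not depend on [l]: a relation between several [l] can then be checked
    on each family [L i] alone. *)
Definition expands (p : nat) (C : (nat -> fsum) -> Prop) (T : nat -> R[i]) :=
  exists (m : nat) (Q : 'I_m -> R[i]) (L : 'I_m -> nat -> fsum),
    (forall i, C (L i)) /\
    forall l, (0 < l < p)%N -> T l = \sum_i Q i * (-1) ^+ l * feval R p (L i l).

Definition combination (p : nat) (s : seq (nat * fsum)) (L : nat -> fsum) : fsum :=
  flatten [seq fmul (freduce p x.2) (freduce p (L x.1)) | x <- s].

Lemma expands_vanish p C T s : prime p -> (2 < p)%N -> expands p C T ->
  all (fun x => 0 < x.1 < p)%N s ->
  (forall L, C L -> fvanish p (combination p s L)) ->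
  \sum_(x <- s) (-1) ^+ x.1 * feval R p x.2 * T x.1 = 0.
Proof.
move=> pp p2 [m [Q [L [CL TE]]]] /allP sp van.
rewrite (eq_big_seq (fun x => \sum_i Q i * feval R p (fmul (freduce p x.2) (freduce p (L i x.1))))).
  rewrite exchange_big big1 // => i _; rewrite -mulr_sumr.
  by rewrite -feval_flatten fvanishP ?mulr0 //; exact: van.
move=> x xs; rewrite TE ?sp // mulr_sumr; apply: eq_bigr => i _.
rewrite feval_mul !feval_reduce //; transitivity (((-1) ^+ x.1 * (-1) ^+ x.1) * (Q i * (feval R
  p x.2 * feval R p (L i x.1)))).
  by ring.
by rewrite -expr2 sqrr_sign mul1r.
Qed.

Section Level.
Variables (p k : nat).
Hypotheses (p_pr : prime p) (p_gt3 : (3 < p)%N) (k0 : (0 < k)%N).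
Let p0 : (0 < p)%N. Proof. exact: prime_gt0. Qed.

Lemma fiber_eq0 l n d : ~~ coprime d k -> fiber_sum (ksum R p l n (p * k)%N) p k d = 0.
Proof.
move=> nco; rewrite /fiber_sum big1 // => j _; rewrite ksum_eq0 //.
apply: contraNN nco; rewrite coprimeMr => /andP[_].
by rewrite -coprime_modl addnC mulnC modnMDl coprime_modl.
Qed.

(** The lifts are chosen once, before [l], and the same choice serves the sums at both cusps. *)
Lemma coprime_lifts : coprime k p -> exists u : 'I_k -> nat * nat, forall B : 'I_k,
  coprime B k -> [/\ ((u B).1 = B %[mod k])%N, coprime (u B).1 (6 * k)%N
    & ((u B).2 * (p ^ 2 * (u B).1) = 1 %[mod 24 * k])%N].
Proof.
move=> cokp.
suff /fin_all_exists[u uP] : forall B : 'I_k, exists x : nat * nat, coprime B k ->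
  [/\ (x.1 = B %[mod k])%N, coprime x.1 (6 * k)%N
    & (x.2 * (p ^ 2 * x.1) = 1 %[mod 24 * k])%N] by exists u.
move=> B.
have [co|//] := boolP (coprime B k); last by exists (0, 0)%N.
have [D DB co6] := coprime6_lift k0 co.
have c24 : coprime (p ^ 2 * D) (24 * k).
  have cop : coprime p (24 * k).
    by rewrite coprimeMr (coprime_sym p k) cokp andbT coprime_sym coprime24.
  rewrite coprimeMl coprimeXl //=; move: co6; rewrite !coprimeMr (@coprimeMr D 4 6).
  rewrite (@coprimeMr D 2 2) (@coprimeMr D 2 3).
  by case/andP => /andP[-> ->] ->.
have m0 : (0 < 24 * k)%N by rewrite muln_gt0.
have [b bE] := modn_inverse m0 c24.
by exists (D, b) => _.
Qed.

Lemma S_inf_coprime_sum (u : 'I_k -> nat * nat) (l n : nat) : coprime k p -> (0 < l < p)%N ->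
  (forall B : 'I_k, coprime B k -> [/\ ((u B).1 = B %[mod k])%N, coprime (u B).1 (6 * k)%N
    & ((u B).2 * (p ^ 2 * (u B).1) = 1 %[mod 24 * k])%N]) ->
  S_inf_inf p l n (p * k)%N = e2pi (- (1 / 8)) * \sum_(B < k | coprime B k)
     kcoef R p k n (u B).2 (u B).1 * (-1) ^+ l *
     (2 * 'i / p%:R * feval R p (block p (k %% p)%N l (n %% p)%N)).
Proof.
move=> cokp lp uP; rewrite S_inf_infE; congr (_ * _).
have per := ksum_modn R p_pr p_gt3 k0 l n.
rewrite (sum_fiber_dilate p0 k0 per); last by rewrite coprime_sym.
rewrite [RHS]big_mkcond; apply: eq_bigr => B _ /=.
case: ifP => co; last first.
  by rewrite fiber_eq0 // coprimeMl (coprime_sym p) cokp co.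
have [uB u6 uu] := uP B co.
rewrite -(fiber_coprime R p_pr p_gt3 k0 n cokp lp uu).
by apply: (fiber_sum_congr p0 k0 per); rewrite -modnMmr -uB modnMmr.
Qed.

Lemma S_inf_coprime (n : nat) : coprime k p ->
  expands p (fun L => L = fun l => block p (k %% p)%N l (n %% p)%N)
    (fun l => S_inf_inf p l n (p * k)%N).
Proof.
move=> cokp; have [u uP] := coprime_lifts cokp.
exists 1%N, (fun=> e2pi (- (1 / 8)) * (2 * 'i / p%:R) *
  \sum_(B < k | coprime B k) kcoef R p k n (u B).2 (u B).1),
  (fun _ l => block p (k %% p)%N l (n %% p)%N).
split=> // l lp; rewrite big_ord_recl big_ord0 addr0 (S_inf_coprime_sum n cokp lp uP).
rewrite -!mulr_suml; ring.
Qed.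

Lemma S_inf_dvd (n : nat) : (p %| k)%N ->
  expands p (fun L => exists2 a, (0 < a < p)%N & L = fun l => block0 p a l (n %% p)%N)
    (fun l => S_inf_inf p l n (p * k)%N).
Proof.
move=> pk.
have [u uP] : exists u : 'I_k -> nat * nat, forall d : 'I_k,
  coprime d k -> ((u d).1 = d %[mod k])%N /\ ((u d).2 * (u d).1 = 1 %[mod 24 * (p * k)])%N.
  suff /fin_all_exists[u uP] : forall d : 'I_k, exists x : nat * nat, coprime d k ->
    (x.1 = d %[mod k])%N /\ (x.2 * x.1 = 1 %[mod 24 * (p * k)])%N by exists u.
  move=> d.
  have [co|//] := boolP (coprime d k); last by exists (0, 0)%N.
  have [D DB co6] := coprime6_lift k0 co.
  have c24 : coprime D (24 * (p * k)).
    move: co6; rewrite !coprimeMr (@coprimeMr D 4 6) (@coprimeMr D 2 2) (@coprimeMr D 2 3).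
    by case/andP => /andP[-> ->] cok; rewrite cok (coprime_dvdr pk cok).
  have m0 : (0 < 24 * (p * k))%N by rewrite !muln_gt0 p0.
  have [b bE] := modn_inverse m0 c24.
  by exists (D, b) => _.
(* A [d] not prime to [k] gets coefficient 0; its dummy residue 1 only keeps the family
   admissible. *)
exists k, (fun d : 'I_k => if coprime d k then
    e2pi (- (1 / 8)) * (2 * 'i / p%:R) * kcoef0 R p k n (u d).2 (u d).1 else 0),
  (fun (d : 'I_k) l => block0 p (if coprime d k then (u d).2 %% p else 1)%N l (n %% p)%N).
split=> [d|l lp].
  exists (if coprime d k then (u d).2 %% p else 1)%N => //.
  case: ifP => co; last by rewrite (ltn_trans _ p_gt3).
  have [_ ad] := uP d co; rewrite ltn_mod p0 andbT lt0n -/(dvdn _ _) -prime_coprime // coprime_sym.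
  move: ad; rewrite mulnC => /modn1_coprime; rewrite !coprimeMr.
  by case/and3P.
rewrite S_inf_infE mulr_sumr /=.
have per := ksum_modn R p_pr p_gt3 k0 l n.
rewrite -mulr_sumr sum_fiber mulr_sumr; apply: eq_bigr => d _ /=.
case: ifP => co; last by rewrite fiber_eq0 ?co // mulr0 !mul0r.
have [uB uu] := uP d co.
rewrite -(fiber_sum_congr p0 k0 per uB) (fiber_dvd R p_pr p_gt3 k0 n pk lp uu).
by ring.
Qed.

End Level.
End Expansions.

(** * The sums at the cusps 0 and infinity for p = 7 *)

Definition gauss7 : fsum :=
  [:: (1, 1%N); (1, 2%N); (-1, 3%N); (1, 4%N); (-1, 5%N); (-1, 6%N)].

(* [block 7] together with the contribution of the sum at [0 oo], in which [2 sqrt 7] is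
   written through the Gauss sum; see [kcoef7E] for the common factor. *)
Definition block7 (k l n : nat) : fsum :=
  fmul [:: ((-1) ^+ jac k 7, 0%N)] (block 7 k l n) ++
  fmul [:: (if (k * l %% 7 == 1)%N then 7 else if (k * l %% 7 == 6)%N then -7 else 0, 0%N)]
    gauss7.

Lemma modn4_inverse x y : (x * y = 1 %[mod 4])%N -> (x %% 4 = y %% 4)%N.
Proof.
rewrite -modnMm; have := ltn_pmod x (isT : 0 < 4)%N; have := ltn_pmod y (isT : 0 < 4)%N.
by move: (x %% 4)%N (y %% 4)%N => [|[|[|[|?]]]] // [|[|[|[|?]]]].
Qed.

Section Seven.
Variable R : realType.

Lemma e2pi_quarter : e2pi (1 / 4 : R) = 'i%R.
Proof.
rewrite /e2pi (_ : 2 * pi * (1 / 4) = pi / 2); last by field.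
by rewrite /expi cos_pihalf sin_pihalf -complexiE.
Qed.

(** Combines the quarter phase and the reciprocity sign in which [kcoef] and [zcoef] differ; it
    makes their ratio free of [b] and [B]. *)
Lemma quarter_phase (b B : nat) : odd B -> (b %% 4 = B %% 4)%N ->
  e2pi (- ((21 * b)%:R / 4) : R) * (-1) ^+ ((7 * B) %% 4 == 3)%N = 'i%R.
Proof.
move=> oB b4; rewrite -e2pi_quarter.
  have [e|e] : (B %% 4 = 1 \/ B %% 4 = 3)%N by lia.
    have -> : ((7 * B) %% 4 = 3)%N by lia.
    rewrite -[(-1) ^+ _]e2pi_half -e2piD eqxx; apply: (@e2pi_congr _ (- Posz (21 * (b %/ 4) + 5))).
    rewrite {1}(_ : b = 4 * (b %/ 4) + 1)%N; last by lia.
    by rewrite mulrNz -pmulrn !(natrD, natrM) /=; field.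
  have -> : ((7 * B) %% 4 = 1)%N by lia.
  rewrite mulr1; apply: (@e2pi_congr _ (- Posz (21 * (b %/ 4) + 16))).
  rewrite {1}(_ : b = 4 * (b %/ 4) + 3)%N; last by lia.
  by rewrite mulrNz -pmulrn !(natrD, natrM); field.
Qed.

(** The square, -7, is a formal computation. The root is selected by [y > 0], where
    [sin (2 pi / 7) - sin (6 pi / 7)] is [- 2 sin (2 pi / 7) cos (4 pi / 7)]. *)
Lemma feval_gauss7 : feval R 7 gauss7 = 'i * (Num.sqrt 7)%:C.
Proof.
have p7 : prime 7 by [].
pose y : R := sin (2 * pi * (1 / 7)) + sin (2 * pi * (2 / 7)) - sin (2 * pi * (3 / 7)).
have gE : feval R 7 gauss7 = 2 * 'i * y%:C.
  have -> : y%:C = sinC R 7 1 + sinC R 7 2 - sinC R 7 3.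
    by rewrite /sinC /y; apply/eqP; rewrite eq_complex /= !addr0 subr0 !eqxx.
  rewrite !sinCE // /feval /gauss7 !big_cons big_nil /= muln1.
  rewrite (@zeta_mod R _ p7 (6 * 2) 5) // (@zeta_mod R _ p7 (6 * 3) 4) //.
  have i0 : ('i : R[i]) != 0 by exact: neq0Ci.
  by field.
have g2 : feval R 7 gauss7 ^+ 2 = - 7.
  apply/eqP; rewrite -subr_eq0 opprK; apply/eqP.
  transitivity (feval R 7 (fmul gauss7 gauss7 ++ [:: (7, 0%N)])).
    by rewrite feval_cat feval_mul /feval big_seq1 /= expr0 mulr1.
  by apply: fvanishP.
have ii : 'i * 'i = -1 :> R[i] by rewrite -expr2 sqr_i.
have y2 : (2 * y) ^+ 2 = 7.
  have : ((2 * y) ^+ 2)%:C = 7 :> R[i].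
    transitivity (- (feval R 7 gauss7 ^+ 2)); last by rewrite g2 opprK.
    rewrite gE (_ : - _ = - ('i * 'i) * (2 * y%:C) ^+ 2); last by ring.
    by rewrite ii opprK mul1r rmorphXn rmorphM /= rmorph_nat.
  by move=> H; apply: (@complexI R); rewrite H rmorph_nat.
have y0 : 0 < y.
  have pi0 := pi_gt0 R.
  have s1 : 0 < sin (2 * pi * (1 / 7)) :> R.
    by apply: sin_gt0_pi; apply/andP; split; nra.
  have s2 : 0 < sin (2 * pi * (2 / 7)) :> R.
    by apply: sin_gt0_pi; apply/andP; split; nra.
  have c2 : cos (2 * pi * (2 / 7)) < 0 :> R.
    rewrite -oppr_gt0 -sinBpihalf.
    by apply: sin_gt0_pi; apply/andP; split; nra.
  have s3 : sin (2 * pi * (1 / 7)) - sin (2 * pi * (3 / 7))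
      = - (2 * (sin (2 * pi * (1 / 7)) * cos (2 * pi * (2 / 7)))) :> R.
    have F x z : sin (x - z) - sin (x + z) = - (2 * (sin z * cos x)) :> R.
      by rewrite sinB sinD; ring.
    by rewrite -F; congr (sin _ - sin _); field.
  by rewrite /y; nra.
have sq : Num.sqrt 7 = 2 * y.
  by rewrite -y2 sqrtr_sqr ger0_norm // mulr_ge0 // ltW.
by rewrite gE sq rmorphM /= rmorph_nat; ring.
Qed.

Section Level.
Variables (k : nat).
Hypotheses (k0 : (0 < k)%N) (cok7 : coprime k 7).
Let kR : (k%:R : R) != 0. Proof. by rewrite pnatr_eq0 -lt0n. Qed.

Definition zcoef (n b B : nat) : R[i] :=
  omega R B k * e2pi ((2 * b)%:R / k%:R + (n * B)%:R / k%:R).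

(* Both sides are instances of [omegaE], for [7 B] and for [B]. *)
Lemma kcoef7E n b B : coprime B (6 * k) -> (b * (7 ^ 2 * B) = 1 %[mod 24 * k])%N ->
  kcoef R 7 k n b B = 'i * (-1) ^+ jac k 7 * zcoef n b B.
Proof.
move=> co bB.
have co7 : coprime (7 * B) (6 * k) by rewrite coprimeMl co andbT coprimeMr (coprime_sym 7 k) cok7.
have i1 : (7 * b * (7 * B) = 1 %[mod 24 * k])%N by rewrite -bB; congr (_ %% _)%N; ring.
have i2 : (49 * b * B = 1 %[mod 24 * k])%N by rewrite -bB; congr (_ %% _)%N; ring.
have oB : odd B := modn1_odd i2.
have oob : odd (49 * b) by apply: (@modn1_odd B _ k); rewrite mulnC.
have b4 : (b %% 4 = B %% 4)%N.
  have := @modn4_inverse (49 * b) B; rewrite -(modnMml 49) mul1n; apply.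
  by apply: modn_dvd_congr i2; exact: dvdn_mulr.
have jE : jac k (7 * B) = jac k 7 (+) jac k B.
  apply: jac_mulr => //; rewrite coprimeMr cok7 coprime_sym.
  by move: co; rewrite coprimeMr => /andP[].
have quarter := quarter_phase oB b4.
rewrite /kcoef /zcoef (omegaE R k0 co7 i1) (omegaE R k0 co i2) jE signr_addb -quarter /=.
set f := (-1) ^+ (_ == 3)%N.
rewrite [LHS](_ : _ = (-1) ^+ jac k 7 * (-1) ^+ jac k B * f * (e2pi (- ((7 * b + 7 * B)%N%:R /
  (24 * k%:R)) - (7 * b * k)%N%:R / 24 + (7 * b)%N%:R / 8) *
   e2pi ((7%:R - 1) * ((b + B)%:R / (24 * k%:R) - (7 * b * k)%:R / 24) + (n * B)%:R / k%:R)));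
     last first.
  by ring.
rewrite [RHS](_ : _ = (-1) ^+ jac k 7 * (-1) ^+ jac k B * f * (e2pi (- ((21 * b)%:R / 4)) * e2pi
  (- ((49 * b + B)%N%:R / (24 * k%:R)) - (49 * b * k)%N%:R / 24 + (49 * b)%N%:R / 8) *
   e2pi ((2 * b)%:R / k%:R + (n * B)%:R / k%:R))); last by ring.
congr (_ * _); rewrite -!e2piD; congr e2pi.
by rewrite !(natrD, natrM); field.
Qed.

End Level.
End Seven.

Section Seven.
Variables (R : realType) (k : nat).
Hypotheses (k0 : (0 < k)%N) (cok7 : coprime k 7).
Let kR : (k%:R : R) != 0. Proof. by rewrite pnatr_eq0 -lt0n. Qed.

Lemma e2pi_modn x : e2pi ((x %% k)%:R / k%:R : R) = e2pi (x%:R / k%:R).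
Proof.
apply: (@e2pi_congr _ (- Posz (x %/ k))); rewrite mulrNz -pmulrn.
by rewrite {2}(divn_eq x k) natrD natrM; field.
Qed.

(** Since [49 b B = 1], the solution is 7 times the residue of [- 7 b]; [k.-1] stands for -1. *)
Lemma S_zero_index (B B' b C : nat) : (B' = B %[mod k])%N ->
  (b * (7 ^ 2 * B') = 1 %[mod k])%N -> (C < 7 * k)%N ->
  (7 %| C)%N && ((B * C)%N%:Z == -1 %[mod k%:Z])%Z = (C == 7 * (7 * b * k.-1 %% k))%N.
Proof.
move=> BB bB Ck.
have e1 : (b * (49 * B) = 1 %[mod k])%N.
  by move: bB; rewrite (_ : 7 ^ 2 = 49)%N // => <-; rewrite -modnMmr -(modnMmr 49) -BB (modnMmr
    49) modnMmr.
have -> : ((B * C)%N%:Z == -1 %[mod k%:Z])%Z = (k %| B * C + 1)%N.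
  by rewrite eqz_mod_dvd opprK.
set x0 := (_ %% k)%N.
have x0b : (k %| x0 + 7 * b)%N.
  rewrite /dvdn modnDml -mulnSr prednK // modnMl //.
apply/andP/eqP => [[/dvdnP[x Cx] kC]|CE].
  rewrite Cx mulnC; congr (_ * _)%N.
  have xk : (x < k)%N by move: Ck; rewrite Cx mulnC ltn_pmul2l.
  have x0k : (x0 < k)%N by rewrite ltn_mod.
  rewrite -(modn_small xk) -(modn_small x0k); apply/eqP.
  rewrite -(eqn_modDr (7 * b)) (eqP x0b).
  rewrite -[X in (X + _)%N]mul1n -modnDml -modnMml -e1 modnMml modnDml.
  have -> : (b * (49 * B) * x + 7 * b = 7 * b * (B * C + 1))%N by rewrite Cx; ring.
  by rewrite -/(dvdn _ _) dvdn_mull.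
split; first by rewrite CE dvdn_mulr.
rewrite /dvdn -modnDmr -e1 modnDmr.
have -> : (B * C + b * (49 * B) = 7 * B * (x0 + 7 * b))%N by rewrite CE; ring.
by rewrite -/(dvdn _ _) dvdn_mull.
Qed.

(** Integrality of [q] makes the phase depend on [C] modulo [k] only, where [C = - 49 b]. *)
Lemma S_zero_sum_eval (n : nat) (q : R) (N : nat) (u : 'I_k -> nat * nat) : q = N%:R ->
  (forall B : 'I_k, coprime B k -> [/\ ((u B).1 = B %[mod k])%N, coprime (u B).1 (6 * k)%N
    & ((u B).2 * (7 ^ 2 * (u B).1) = 1 %[mod 24 * k])%N]) ->
  S_zero_inf_sum q n k = \sum_(B < k | coprime B k)
    e2pi (- (q * (49 * (u B).2)%:R / k%:R)) * (omega R (u B).1 k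
      * e2pi ((n * (u B).1)%:R / k%:R)).
Proof.
move=> qN uP; apply: eq_bigr => B co; have [uB u6 uu] := uP B co.
set b := (u B).2 in uu *.
have uk : (b * (7 ^ 2 * (u B).1) = 1 %[mod k])%N by apply: modn_dvd_congr uu; exact: dvdn_mull.
pose x0 := (7 * b * k.-1 %% k)%N.
have C0 : (7 * x0 < 7 * k)%N by rewrite ltn_pmul2l // ltn_mod.
rewrite (big_pred1 (Ordinal C0)) => [|C /=]; last first.
  by rewrite (S_zero_index uB uk (ltn_ord C)) -val_eqE.
have /dvdnP[t Et] : (k %| x0 + 7 * b)%N.
  by rewrite /dvdn modnDml -mulnSr prednK // modnMl.
rewrite -mulrA; congr (_ * (_ * _)).
- apply: (@e2pi_congr _ (Posz (N * 7 * t))); rewrite qN -pmulrn /= -/x0 [(7 * x0)%:R]natrM.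
  have -> : x0%:R = t%:R * k%:R - 7 * b%:R :> R by rewrite -!natrM -Et natrD addrK.
  by rewrite !natrM; field.
- by apply/esym/omega_congr => //; rewrite // coprime_modl.
- by rewrite -[_%:~R * _]natrM -(e2pi_modn (n * B)) -(e2pi_modn (n * (u B).1)) -(modnMmr n B)
  -(modnMmr n (u B).1) uB.
Qed.

(** Both quadratic coefficients are [T (3 T + 1) / 2] or [T (3 T - 1) / 2]. Substituting
    [7 T = k l - 1], respectively [k l + 1], into 49 times them gives [(3 k^2 l^2 + k l - 4) / 2],
    respectively [(3 k^2 l^2 - k l - 4) / 2]. The common constant -2 yields the phase [2 b / k] of
    [zcoef], and [l] remains only in signs. *)
Lemma S_zero_eval (n l : nat) (u : 'I_k -> nat * nat) :
  (forall B : 'I_k, coprime B k -> [/\ ((u B).1 = B %[mod k])%N, coprime (u B).1 (6 * k)%N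
    & ((u B).2 * (7 ^ 2 * (u B).1) = 1 %[mod 24 * k])%N]) ->
  S_zero_inf l n k =
   (if (k * l %% 7 == 1)%N then -1 else if (k * l %% 7 == 6)%N then 1 else 0) *
   (-1) ^+ l * \sum_(B < k | coprime B k) zcoef R k n (u B).2 (u B).1.
Proof.
move=> uP; rewrite /S_zero_inf.
have oddb (B : 'I_k) : coprime B k -> odd (u B).2.
  by move=> /uP[_ _]; rewrite mulnC => /modn1_odd.
case: eqP => [E1|_].
  set T := (k * l %/ 7)%N.
  have kl : (k * l = 7 * T + 1)%N by rewrite {1}(divn_eq (k * l) 7) E1 mulnC.
  have ev : ~~ odd (T * (3 * T + 1)) by rewrite oddM oddD oddM /=; case: odd.
  rewrite (@S_zero_sum_eval n _ (T * (3 * T + 1))./2 u) //; last first.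
    by rewrite natr_half // !(natrM, natrD); field.
  rewrite !mulr_sumr; apply: eq_bigr => B co; rewrite /zcoef.
  set b := (u B).2; have ob : odd b := oddb B co.
  have klR : k%:R * l%:R = 7 * T%:R + 1 :> R by rewrite -natrM kl natrD natrM.
  have phase : e2pi (- ((3 / 2 * T%:R ^+ 2 + 1 / 2 * T%:R) * (49 * b)%:R / k%:R))
      = (-1) ^+ (l * (k + 1)) * e2pi ((2 * b)%:R / k%:R) :> R[i].
    have ev2 : ~~ odd (b * (3 * k * l * l + l) + l * (k + 1)).
      by rewrite !(oddM, oddD) ob /=; case: (odd k); case: (odd l).
    rewrite -e2pi_half -e2piD.
    apply: (@e2pi_congr _ (- Posz (b * (3 * k * l * l + l) + l * (k + 1))./2)).
    rewrite mulrNz -pmulrn natr_half //.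
    have -> : (3 / 2 * T%:R ^+ 2 + 1 / 2 * T%:R) * (49 * b)%:R
       = (3 * (7 * T%:R) ^+ 2 + 7 * (7 * T%:R)) / 2 * b%:R :> R by rewrite natrM; field.
    rewrite (_ : 7 * T%:R = k%:R * l%:R - 1); last by rewrite klR addrK.
    by rewrite !(natrM, natrD); field.
  rewrite phase e2piD.
  have -> : (-1) ^+ (k * l - (k * l) %% 7) = - (-1) ^+ (k * l) :> R[i].
    by rewrite E1 -[in RHS](@prednK (k * l)) ?exprS ?mulN1r ?opprK ?subn1 // kl addn1.
  have sgn : (-1) ^+ (k * l) * (-1) ^+ (l * (k + 1)) = (-1) ^+ l :> R[i].
    rewrite -exprD -signr_odd -[RHS]signr_odd !(oddD, oddM) /=.
    by case: (odd k); case: (odd l).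
  by rewrite -[in RHS]sgn; ring.
case: eqP => [E6|_]; last by rewrite !mul0r.
set T := ((k * l).+1 %/ 7)%N.
have kl : (k * l + 1 = 7 * T)%N by have := divn_eq (k * l) 7; rewrite E6 /T; lia.
have ev : ~~ odd (T * (3 * T + 1)) by rewrite oddM oddD oddM /=; case: odd.
have T0 : (0 < T)%N by lia.
have klR : 7 * T%:R = k%:R * l%:R + 1 :> R by rewrite -natrM -kl natrD natrM.
(* The coefficient written in [T - 1] equals [T (3 T - 1) / 2], that is [T (3 T + 1) / 2 - T]. *)
rewrite (@S_zero_sum_eval n _ ((T * (3 * T + 1))./2 - T) u) //; last first.
  rewrite natrB ?natr_half // ?(natrM, natrD); first by field.
  by rewrite -leq_double even_halfK //; nia.
rewrite !mulr_sumr; apply: eq_bigr => B co; rewrite /zcoef.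
set b := (u B).2; have ob : odd b := oddb B co.
have phase : e2pi (- ((3 / 2 * (T%:R - 1) ^+ 2 + 5 / 2 * (T%:R - 1) + 1) * (49 * b)%:R / k%:R))
    = (-1) ^+ (l * (k + 1)) * e2pi ((2 * b)%:R / k%:R) :> R[i].
  have ev2 : ~~ odd (b * (3 * k * l * l + l) + l * (k + 1)).
    by rewrite !(oddM, oddD) ob /=; case: (odd k); case: (odd l).
  rewrite -e2pi_half -e2piD.
  apply: (@e2pi_congr _ (- Posz (b * (3 * k * l * l + l) + l * (k + 1))./2 + Posz (b * l))).
  rewrite intrD mulrNz -!pmulrn natr_half //.
  have -> : (3 / 2 * (T%:R - 1) ^+ 2 + 5 / 2 * (T%:R - 1) + 1) * (49 * b)%:R
     = (3 * (7 * T%:R) ^+ 2 - 7 * (7 * T%:R)) / 2 * b%:R :> R by rewrite natrM; field.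
  by rewrite klR !(natrM, natrD); field.
rewrite phase e2piD.
have -> : (-1) ^+ (k * l - (k * l) %% 7) = (-1) ^+ (k * l) :> R[i].
  rewrite E6 -signr_odd -[RHS]signr_odd oddB ?addbF // -E6; exact: leq_mod.
have sgn : (-1) ^+ (k * l) * (-1) ^+ (l * (k + 1)) = (-1) ^+ l :> R[i].
  rewrite -exprD -signr_odd -[RHS]signr_odd !(oddD, oddM) /=.
  by case: (odd k); case: (odd l).
by rewrite -[in RHS]sgn; ring.
Qed.

End Seven.

(** * Linear relations *)

(* A linear relation between the [T l], given by its coefficients [s], holds as soon as
   it holds for the blocks attached to each residue class modulo [p]. *)
Definition relation_holds (p : nat) (blk : nat -> nat -> nat -> fsum)
    (s : seq (nat * fsum)) (n : nat) : bool :=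
  all (fun x => 0 < x.1 < p)%N s &&
  all (fun a => fvanish p (combination p s (fun l => blk a l n))
             && fvanish p (combination p s (fun l => block0 p a l n))) (iota 1 p.-1).

Definition fcos (p a b : nat) : fsum :=
  [:: (1, a); (1, (p.-1 * a)%N); (-1, b); (-1, (p.-1 * b)%N)].

(** Multiplying by [p.+1./2] halves [l] modulo [p], so the value is [2 i sin (pi l + pi l / p)],
    which is [2 i sin (pi l / p)] up to the sign [(-1)^l]. *)
Definition fsin (p l : nat) : fsum :=
  [:: (1, (p.+1./2 * l)%N); (-1, (p.-1 * (p.+1./2 * l))%N)].

Section Relations.
Variable R : realType.

Definition fibre_block p (blk : nat -> nat -> nat -> fsum) n (L : nat -> fsum) : Prop :=
  exists2 a, (0 < a < p)%N & L = (fun l => blk a l n) \/ L = (fun l => block0 p a l n).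

Lemma expands_sub p (C C' : (nat -> fsum) -> Prop) (T : nat -> R[i]) :
  (forall L, C L -> C' L) -> expands p C T -> expands p C' T.
Proof. by move=> CC [m [Q [L [CL TE]]]]; exists m, Q, L; split=> // i; apply: CC. Qed.

Lemma relation_holdsP p blk s n (T : nat -> R[i]) : prime p -> (2 < p)%N ->
  expands p (fibre_block p blk n) T -> relation_holds p blk s n ->
  \sum_(x <- s) (-1) ^+ x.1 * feval R p x.2 * T x.1 = 0.
Proof.
move=> pp p2 ex /andP[sp /allP ch]; apply: (expands_vanish pp p2 ex sp) => L [a ap LE].
have /ch/andP[h h0] : a \in iota 1 p.-1 by rewrite mem_iota; lia.
by case: LE => ->.
Qed.

Lemma modn_gt0_lt k p : (0 < p)%N -> ~~ (p %| k)%N -> (0 < k %% p < p)%N.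
Proof. by move=> p0 pk; rewrite ltn_mod p0 andbT lt0n. Qed.

Lemma S_inf_expands p k (n : nat) : prime p -> (3 < p)%N -> (0 < k)%N ->
  expands p (fibre_block p (block p) (n %% p)%N) (fun l => S_inf_inf p l n (p * k)%N : R[i]).
Proof.
move=> pp p3 k0; have [pk|npk] := boolP (p %| k)%N.
  apply: expands_sub (S_inf_dvd R pp p3 k0 n pk) => L [a ap LE].
  by exists a => //; right.
have cok : coprime k p by rewrite coprime_sym prime_coprime.
apply: expands_sub (S_inf_coprime R pp p3 k0 n cok) => L LE.
by exists (k %% p)%N; [rewrite modn_gt0_lt // prime_gt0|left].
Qed.

Definition T7 (n k l : nat) : R[i] :=
  e2pi (- (1 / 8)) * S_inf_inf 7 l n (7 * k)%N
   + (((k * l) %% 7 == 1) || ((k * l) %% 7 == 6))%N%:R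
     * (2 * (Num.sqrt 7)%:C * S_zero_inf l n k).

(** If 7 divides [k], the indicator is 0. Otherwise both cusps share the constant [Z], by [kcoef7E],
    and one family is enough. *)
Lemma T7_expands k n : (0 < k)%N ->
  expands 7 (fibre_block 7 block7 (n %% 7)%N) (T7 n k).
Proof.
move=> k0; have p7 : prime 7 by [].
have [pk|npk] := boolP (7 %| k)%N.
  have [m [Q [L [CL SE]]]] := S_inf_dvd R p7 isT k0 n pk.
  exists m, (fun i => e2pi (- (1 / 8)) * Q i), L; split=> [i|l lp].
    by have [a ap LE] := CL i; exists a => //; right.
  have kl : (k * l %% 7 = 0)%N by apply/eqP; exact: dvdn_mulr.
  rewrite /T7 kl mul0r addr0 SE // mulr_sumr; apply: eq_bigr => i _.
  by rewrite !mulrA.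
have cok : coprime k 7 by rewrite coprime_sym prime_coprime.
have [u uP] := coprime_lifts p7 isT k0 cok.
pose Z := \sum_(B < k | coprime B k) zcoef R k n (u B).2 (u B).1.
exists 1%N, (fun=> 2 * 'i / 7 * Z), (fun _ l => block7 (k %% 7)%N l (n %% 7)%N); split=> [_|l lp].
  by exists (k %% 7)%N; [rewrite modn_gt0_lt|left].
rewrite big_ord_recl big_ord0 addr0 /T7 (S_inf_coprime_sum R p7 isT k0 n cok lp uP).
rewrite (S_zero_eval R k0 cok n l uP) -/Z.
have -> : \sum_(B < k | coprime B k) kcoef R 7 k n (u B).2 (u B).1 * (-1) ^+ l *
     (2 * 'i / 7 * feval R 7 (block 7 (k %% 7)%N l (n %% 7)%N))
  = 'i * (-1) ^+ jac k 7 * Z * (-1) ^+ l * (2 * 'i / 7 * feval R 7 (block 7 (k %% 7)%N l (n %%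
    7)%N)).
  rewrite -!mulr_suml; do 2!congr (_ * _); rewrite /Z mulr_sumr; apply: eq_bigr => B co.
  by have [_ u6 uu] := uP B co; rewrite (kcoef7E R k0 cok n u6 uu).
rewrite /block7 feval_cat !feval_mul feval_gauss7 !feval_seq1 !expr0 !mulr1.
rewrite rmorph_sign (@jac_congr (k %% 7) k 7) ?modn_mod // modnMml.
(* One factor comes from the definition of [T7], one from inside the Kloosterman sum; together they
   cancel the i of [kcoef7E]. *)
have e8 : e2pi (- (1 / 8)) * e2pi (- (1 / 8)) * 'i = 1 :> R[i].
  by rewrite -e2pi_quarter -!e2piD -(e2pi0 R); congr e2pi; field.
have ii : 'i * 'i = -1 :> R[i] by rewrite -expr2 sqrCi.
set F := feval _ _ _; set E8 := e2pi _ in e8 *.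
set J := (-1) ^+ jac k 7; set sq := (Num.sqrt 7)%:C; set s := (-1) ^+ l.
have main : E8 * (E8 * ('i * J * Z * s * (2 * 'i / 7 * F))) = 2 * 'i / 7 * Z * s * J * F.
  transitivity ((E8 * E8 * 'i) * (2 * 'i / 7 * Z * s * J * F)); first by ring.
  by rewrite e8 mul1r.
have zero (e : int) : 2 * 'i / 7 * Z * s * ((- 7 * e)%:~R * ('i * sq)) = 2 * sq * (e%:~R * s * Z).
  rewrite intrM.
  transitivity (- ('i * 'i) * (2 * sq * (e%:~R * s * Z))); last by rewrite ii opprK mul1r.
  by field.
rewrite main mulrDr; congr (_ + _); first by ring.

case: eqP => [_|_]; first by rewrite mul1r -(zero (-1)).
case: eqP => [_|_]; first by have := zero 1; rewrite mulr1 => ->; rewrite /= mulr1z !mul1r.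
by rewrite !mul0r mulr0.
Qed.

End Relations.

(** * Cosine and sine coefficients, and assembly of the identities *)

Section Final.
Variable R : realType.

(** All indices in the identities are even, so the cosines are half-sums of powers of [zeta]. *)
Lemma Ccos_fcos p (a b : nat) (x y : int) : prime p -> x = (2 * a)%N -> y = (2 * b)%N ->
  Ccos p x y = feval R p (fcos p a b) / 2.
Proof.
move=> pp -> ->; have p0 := prime_gt0 pp.
have pR : (p%:R : R) != 0 by rewrite pnatr_eq0 -lt0n.
have cosE (m : nat) : (cos ((2 * m)%N%:R * pi / p%:R))%:C
    = (zeta R p ^+ m + zeta R p ^+ (p.-1 * m)) / 2 :> R[i].
  have -> : (2 * m)%N%:R * pi / p%:R = 2 * pi * (m%:R / p%:R) :> R by rewrite natrM; field.
  rewrite cos_expi -mulrN -!/(e2pi _) !zetaX; congr ((_ + _) / _).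
  apply: (@e2pi_congr _ (- Posz m)); rewrite natrM -subn1 natrB // mulrNz -pmulrn.
  by field.
rewrite /Ccos rmorphB /= -!pmulrn !cosE /fcos /feval !big_cons big_nil /=.
by field.
Qed.

Lemma sin_frac_pi_fsin p l : prime p -> (2 < p)%N ->
  sin_frac_pi l p = (-1) ^+ l * feval R p (fsin p l) / (2 * 'i).
Proof.
move=> pp p2; have p0 := prime_gt0 pp.
have pR : (p%:R : R) != 0 by rewrite pnatr_eq0 -lt0n.
have oddp : odd p by case: (even_prime pp) p2 => [->|].
have -> : feval R p (fsin p l) = sinC R p (p.+1./2 * l) * (2 * 'i).
  rewrite sinCE // divfK ?mulf_neq0 ?pnatr_eq0 ?neq0Ci //.
  by rewrite /feval /fsin !big_cons big_nil /=; ring.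
rewrite mulrA mulfK ?mulf_neq0 ?pnatr_eq0 ?neq0Ci // /sinC -complex_sign /sin_frac_pi.
congr (_ %:C); rewrite -sin_shift.
have hE : (p.+1./2)%:R = (p%:R + 1) / 2 :> R by rewrite natr_half ?natr1 //= oddp.
rewrite (_ : _ + _ = l%:R * pi / p%:R + pi * (2 * l)%:R); last first.
  by rewrite !natrM hE; field.
by rewrite sin_shift -signr_odd oddM mul1r.
Qed.

Definition sine_term (p l : nat) (f : fsum) : nat * fsum := (l, fmul f (fsin p l)).

Lemma relation5 (n k r : nat) (C1 C2 : R[i]) (f1 f2 : fsum) : (0 < k)%N -> (n %% 5 = r)%N ->
  C1 = feval R 5 f1 / 2 -> C2 = feval R 5 f2 / 2 ->
  relation_holds 5 (block 5) [:: sine_term 5 1 f1; sine_term 5 2 f2] r ->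
  C1 * sin_frac_pi 1 5 * S_inf_inf 5 1 n (5 * k)%N
  + C2 * sin_frac_pi 2 5 * S_inf_inf 5 2 n (5 * k)%N = 0.
Proof.
move=> k0 <- -> -> /(relation_holdsP _ _ (S_inf_expands R n _ _ k0)).
move=> /(_ isT isT isT isT); rewrite !big_cons big_nil /= !feval_mul !sin_frac_pi_fsin // => E.
have i0 : ('i : R[i]) != 0 by exact: neq0Ci.
(* The factor [4 i] collects the denominator 2 of the cosines and [2 i] of the sines. *)
by rewrite -[RHS](mul0r (4 * 'i)^-1) -E; field.
Qed.

Lemma S7E l (n k : nat) : S7 l n (7 * k)%N = sin_frac_pi l 7 * T7 R n k l.
Proof. by rewrite /S7 mulKn. Qed.

Lemma T7_in (n k l : nat) : ((k * l) %% 7 == 1)%N || ((k * l) %% 7 == 6)%N ->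
  T7 R n k l = e2pi (- (1 / 8)) * S_inf_inf 7 l n (7 * k)%N
    + 2 * (Num.sqrt 7)%:C * S_zero_inf l n k.
Proof. by rewrite /T7 => ->; congr (_ + _); exact: mul1r. Qed.

Lemma T7_out (n k l : nat) : ~~ (((k * l) %% 7 == 1)%N || ((k * l) %% 7 == 6)%N) ->
  T7 R n k l = e2pi (- (1 / 8)) * S_inf_inf 7 l n (7 * k)%N.
Proof. by move=> /negPf E; rewrite /T7 E mul0r addr0. Qed.

Lemma relation7 (n k r : nat) (C1 C2 C3 : R[i]) (f1 f2 f3 : fsum) : (0 < k)%N -> (n %% 7 = r)%N ->
  C1 = feval R 7 f1 / 2 -> C2 = feval R 7 f2 / 2 -> C3 = feval R 7 f3 / 2 ->
  relation_holds 7 block7 [:: sine_term 7 1 f1; sine_term 7 2 f2; sine_term 7 3 f3] r ->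
  C1 * S7 1 n (7 * k)%N + C2 * S7 2 n (7 * k)%N + C3 * S7 3 n (7 * k)%N = 0.
Proof.
move=> k0 <- -> -> -> /(relation_holdsP _ _ (T7_expands R n k0)).
move=> /(_ isT isT); rewrite !big_cons big_nil /= !feval_mul !S7E !sin_frac_pi_fsin // => E.
have i0 : ('i : R[i]) != 0 by exact: neq0Ci.
by rewrite -[RHS](mul0r (4 * 'i)^-1) -E; field.
Qed.

Lemma relation1 p blk (T : nat -> R[i]) l n : prime p -> (2 < p)%N ->
  expands p (fibre_block p blk n) T ->
  relation_holds p blk [:: (l, [:: (1, 0%N)])] n -> T l = 0.
Proof.
move=> pp p2 ex /(relation_holdsP pp p2 ex); rewrite big_seq1 /= feval_seq1 mulr1z expr0 !mulr1.
by move/eqP; rewrite mulf_eq0 signr_eq0 => /eqP.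
Qed.

End Final.

Theorem theorem1p3 (R : realType) (n : int) (n_ge0 : 0 <= n) :
  ((forall l c : nat, (1 <= l <= 4)%N -> (0 < c)%N -> (5 %| c)%N ->
      S_inf_inf 5 l (5 * n + 4) c = 0 :> R[i])
   /\
   (forall l c : nat, (1 <= l <= 6)%N -> (0 < c)%N -> (7 %| c)%N ->
      (((c %/ 7) * l)%N%:Z <> 1 %[mod 7])%Z ->
      (((c %/ 7) * l)%N%:Z <> -1 %[mod 7])%Z ->
      S_inf_inf 7 l (7 * n + 5) c = 0 :> R[i])
   /\
   (forall l a c : nat, (1 <= l <= 6)%N -> (0 < a)%N -> ~~ (7 %| a)%N ->
      ((a * l)%N%:Z = 1 %[mod 7])%Z \/ ((a * l)%N%:Z = -1 %[mod 7])%Z ->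
      c = (7 * a)%N ->
      e2pi (- (1 / 8)) * S_inf_inf 7 l (7 * n + 5) c
        + 2 * (Num.sqrt 7)%:C * S_zero_inf l (7 * n + 5) a = 0 :> R[i]))
  /\
  (forall c : nat, (0 < c)%N -> (5 %| c)%N ->
     Ccos 5 2 4 * sin_frac_pi 1 5 * S_inf_inf 5 1 (5 * n + 1) c
       + Ccos 5 4 2 * sin_frac_pi 2 5 * S_inf_inf 5 2 (5 * n + 1) c = 0 :> R[i]
     /\
     Ccos 5 0 4 * sin_frac_pi 1 5 * S_inf_inf 5 1 (5 * n + 2) c
       + Ccos 5 0 2 * sin_frac_pi 2 5 * S_inf_inf 5 2 (5 * n + 2) c = 0 :> R[i])
  /\
  (forall c : nat, (0 < c)%N -> (7 %| c)%N ->
     Ccos 7 4 6 * S7 1 (7 * n) c + Ccos 7 6 2 * S7 2 (7 * n) c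
       + Ccos 7 2 4 * S7 3 (7 * n) c = 0 :> R[i]
     /\
     Ccos 7 2 4 * S7 1 (7 * n + 1) c + Ccos 7 4 6 * S7 2 (7 * n + 1) c
       + Ccos 7 6 2 * S7 3 (7 * n + 1) c = 0 :> R[i]
     /\
     Ccos 7 4 6 * S7 1 (7 * n + 1) c + Ccos 7 6 2 * S7 2 (7 * n + 1) c
       + Ccos 7 2 4 * S7 3 (7 * n + 1) c = 0 :> R[i]
     /\
     Ccos 7 0 6 * S7 1 (7 * n + 2) c + Ccos 7 0 2 * S7 2 (7 * n + 2) c
       + Ccos 7 0 4 * S7 3 (7 * n + 2) c = 0 :> R[i]
     /\
     Ccos 7 0 4 * S7 1 (7 * n + 3) c + Ccos 7 0 6 * S7 2 (7 * n + 3) c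
       + Ccos 7 0 2 * S7 3 (7 * n + 3) c = 0 :> R[i]
     /\
     Ccos 7 2 6 * S7 1 (7 * n + 3) c + Ccos 7 4 2 * S7 2 (7 * n + 3) c
       + Ccos 7 6 4 * S7 3 (7 * n + 3) c = 0 :> R[i]
     /\
     Ccos 7 0 2 * S7 1 (7 * n + 4) c + Ccos 7 0 4 * S7 2 (7 * n + 4) c
       + Ccos 7 0 6 * S7 3 (7 * n + 4) c = 0 :> R[i]
     /\
     Ccos 7 2 6 * S7 1 (7 * n + 4) c + Ccos 7 4 2 * S7 2 (7 * n + 4) c
       + Ccos 7 6 4 * S7 3 (7 * n + 4) c = 0 :> R[i]
     /\
     (Ccos 7 0 4 + Ccos 7 2 6) * S7 1 (7 * n + 6) c
       + (Ccos 7 0 6 + Ccos 7 4 2) * S7 2 (7 * n + 6) c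
       + (Ccos 7 0 2 + Ccos 7 6 4) * S7 3 (7 * n + 6) c = 0 :> R[i]).
Proof.
case: n n_ge0 => // n _.
have nE (p r : nat) : p%:Z * n%:Z + r%:Z = (p * n + r)%N%:Z by rewrite PoszD PoszM.
have r5 r : ((5 * n + r) %% 5 = r %% 5)%N by rewrite mulnC modnMDl.
have r7 r : ((7 * n + r) %% 7 = r %% 7)%N by rewrite mulnC modnMDl.
have e7 : 7 * n%:Z = (7 * n + 0)%N%:Z by rewrite addn0 PoszM.
have split p (c : nat) : (0 < p)%N -> (0 < c)%N -> (p %| c)%N -> exists2 k, (0 < k)%N & c = (p *
  k)%N.
  move=> p0 c0 /dvdnP[k E]; exists k; last by rewrite mulnC.
  by move: c0; rewrite E muln_gt0 => /andP[].
have T5 l : (1 <= l <= 4)%N -> l \in iota 1 4 by rewrite mem_iota; lia.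
have T7l l : (1 <= l <= 6)%N -> l \in iota 1 6 by rewrite mem_iota; lia.
have vanish5 : all (fun l => relation_holds 5 (block 5) [:: (l, [:: (1, 0%N)])] 4) (iota 1 4).
  by vm_cast_no_check (erefl true).
have vanish7 : all (fun l => relation_holds 7 block7 [:: (l, [:: (1, 0%N)])] 5) (iota 1 6).
  by vm_cast_no_check (erefl true).
(* This one vanishing contains both statements for [7 n + 5]: the indicator in [T7] tells them
   apart. *)
have T7_0 l k : (1 <= l <= 6)%N -> (0 < k)%N -> T7 R (7 * n + 5) k l = 0.
  move=> /T7l lI k0; apply: (relation1 (isT : prime 7) isT (T7_expands R (7 * n + 5) k0)).
  by rewrite r7; exact: (allP vanish7).
have C5 a b (x y : int) := @Ccos_fcos R 5 a b x y isT.
have C7 a b (x y : int) := @Ccos_fcos R 7 a b x y isT.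
split; [split; [|split]|split].
- move=> l c /T5 l4 c0 /(split 5%N c isT c0)[k k0 ->].
  rewrite (nE 5 4)%N.
  apply: (relation1 (isT : prime 5) isT (S_inf_expands R (5 * n + 4) (isT : prime 5) isT k0) _).
  by rewrite r5; exact: (allP vanish5).
- move=> l c l6 c0 /(split 7%N c isT c0)[k k0 ->]; rewrite (mulKn k (isT : 0 < 7)%N) => k1 k6.
  rewrite (nE 7 5)%N; apply/eqP; rewrite -(mulrI_eq0 _ (mulfI (e2pi_neq0 (- (1 / 8) : R)))).
  rewrite -(@T7_out R (7 * n + 5) k l); first by apply/eqP; exact: T7_0.
  by rewrite negb_or; apply/andP; split; apply/eqP; lia.
- move=> l a c l6 a0 _ al ->; rewrite (nE 7 5)%N -(@T7_in R (7 * n + 5) a l); first exact: T7_0.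
  by case: al; lia.
- move=> c c0 /(split 5%N c isT c0)[k k0 ->]; rewrite (nE 5 1)%N (nE 5 2)%N; split.
    apply: (@relation5 R (5 * n + 1) k 1 _ _ _ _ k0 (r5 1%N) (C5 1%N 2%N 2 4 erefl erefl) (C5
      2%N 1%N 4 2 erefl erefl)).
    by vm_cast_no_check (erefl true).
  apply: (@relation5 R (5 * n + 2) k 2 _ _ _ _ k0 (r5 2%N) (C5 0%N 2%N 0 4 erefl erefl) (C5 0%N
    1%N 0 2 erefl erefl)).
  by vm_cast_no_check (erefl true).
move=> c c0 /(split 7%N c isT c0)[k k0 ->].
rewrite (nE 7 1)%N (nE 7 2)%N (nE 7 3)%N (nE 7 4)%N (nE 7 6)%N e7.
split.
  apply: (@relation7 R (7 * n + 0) k 0 _ _ _ _ _ _ k0 (r7 0%N) (C7 2%N 3%N 4 6 erefl erefl)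
    (C7 3%N 1%N 6 2 erefl erefl) (C7 1%N 2%N 2 4 erefl erefl)).
  by vm_cast_no_check (erefl true).
split.
  apply: (@relation7 R (7 * n + 1) k 1 _ _ _ _ _ _ k0 (r7 1%N) (C7 1%N 2%N 2 4 erefl erefl)
    (C7 2%N 3%N 4 6 erefl erefl) (C7 3%N 1%N 6 2 erefl erefl)).
  by vm_cast_no_check (erefl true).
split.
  apply: (@relation7 R (7 * n + 1) k 1 _ _ _ _ _ _ k0 (r7 1%N) (C7 2%N 3%N 4 6 erefl erefl)
    (C7 3%N 1%N 6 2 erefl erefl) (C7 1%N 2%N 2 4 erefl erefl)).
  by vm_cast_no_check (erefl true).
split.
  apply: (@relation7 R (7 * n + 2) k 2 _ _ _ _ _ _ k0 (r7 2%N) (C7 0%N 3%N 0 6 erefl erefl)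
    (C7 0%N 1%N 0 2 erefl erefl) (C7 0%N 2%N 0 4 erefl erefl)).
  by vm_cast_no_check (erefl true).
split.
  apply: (@relation7 R (7 * n + 3) k 3 _ _ _ _ _ _ k0 (r7 3%N) (C7 0%N 2%N 0 4 erefl erefl)
    (C7 0%N 3%N 0 6 erefl erefl) (C7 0%N 1%N 0 2 erefl erefl)).
  by vm_cast_no_check (erefl true).
split.
  apply: (@relation7 R (7 * n + 3) k 3 _ _ _ _ _ _ k0 (r7 3%N) (C7 1%N 3%N 2 6 erefl erefl)
    (C7 2%N 1%N 4 2 erefl erefl) (C7 3%N 2%N 6 4 erefl erefl)).
  by vm_cast_no_check (erefl true).
split.
  apply: (@relation7 R (7 * n + 4) k 4 _ _ _ _ _ _ k0 (r7 4%N) (C7 0%N 1%N 0 2 erefl erefl)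
    (C7 0%N 2%N 0 4 erefl erefl) (C7 0%N 3%N 0 6 erefl erefl)).
  by vm_cast_no_check (erefl true).
split.
  apply: (@relation7 R (7 * n + 4) k 4 _ _ _ _ _ _ k0 (r7 4%N) (C7 1%N 3%N 2 6 erefl erefl)
    (C7 2%N 1%N 4 2 erefl erefl) (C7 3%N 2%N 6 4 erefl erefl)).
  by vm_cast_no_check (erefl true).
(* The last identity has sums of two cosine differences as coefficients; formal sums add by
   concatenation. *)
have D7 (x y : R[i]) f g : x = feval R 7 f / 2 -> y = feval R 7 g / 2 ->
  x + y = feval R 7 (f ++ g) / 2 by move=> -> ->; rewrite feval_cat mulrDl.
apply: (@relation7 R (7 * n + 6) k 6 _ _ _ _ _ _ k0 (r7 6%N) (D7 _ _ _ _ (C7 0%N 2%N 0 4 erefl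
  erefl) (C7 1%N 3%N 2 6 erefl erefl))
  (D7 _ _ _ _ (C7 0%N 3%N 0 6 erefl erefl) (C7 2%N 1%N 4 2 erefl erefl))
  (D7 _ _ _ _ (C7 0%N 1%N 0 2 erefl erefl) (C7 3%N 2%N 6 4 erefl erefl))).
by vm_cast_no_check (erefl true).
Qed.
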